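(* Let $p,q$ be positive integers, let $A\in\mathscr{S}^{p,q}$ be a separable matrix, and let $\mathbf{a}=(A_b)_{b\in\mathcal{E}}$ be the associated vector of entries of $A$ indexed by $\mathcal{E}$. Let $h=(x^Tx-1,\ y^Ty-1)$ and $g=(\mathbf{1}_p^Tx,\ \mathbf{1}_q^Ty)$. For a polynomial $R\in\Sigma[x,y]_6$ and an integer $k\ge3$ consider the semidefinite relaxation $$\min\ \langle R,w\rangle\quad\text{s.t.}\quad w|_{\mathcal{E}}=\mathbf{a},\ L_h^{(k)}(w)=0,\ M_k(w)\succeq0,\ L_g^{(k)}(w)\succeq0,\ w\in\mathbb{R}^{\mathbb{M}[x,y]_{2k}}. \qquad(\ast)$$ For a generic polynomial $R\in\Sigma[x,y]_6$, we have: (i) For all $k\ge3$, the relaxation $(\ast)$ has an optimizer $w^{*,k}$. (ii) For all $t$ sufficiently large, the truncated sequence $\{w^{*,k}|_{2t}\}_{k}$ (over $k\ge t$, where $w^{*,k}$ is an optimizer of $(\ast)$) is bounded, and all its accumulation points are flat extensions of $\mathbf{a}$.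
   Context: $\mathcal{S}^k_+$ is the cone of real symmetric positive semidefinite $k\times k$ matrices; $X\succeq0$ means positive semidefinite. $\mathbf{1}_p$ is the all-ones vector in $\mathbb{R}^p$. $\otimes$ is the Kronecker product, $B\otimes C=(B_{ik}C)_{1\le i,k\le p}$. A matrix $A$ is separable if $A=\sum_{j=1}^LB_j\otimes C_j$ for some $L$ and some $B_j\in\mathcal{S}^p_+$, $C_j\in\mathcal{S}^q_+$; $\mathscr{S}^{p,q}$ is the cone of separable matrices. Variables are $x=(x_1,\dots,x_p)$, $y=(y_1,\dots,y_q)$. $\mathcal{E}=\{x_iy_jx_ky_l:1\le i\le k\le p,\ 1\le j\le l\le q\}$, and for $b=x_iy_jx_ky_l\in\mathcal{E}$ one sets $A_b:=A_{(i-1)q+j,\,(k-1)q+l}$. $\mathbb{M}[x,y]_d$ is the set of monomials in $(x,y)$ of degree at most $d$; $\mathbb{R}[x,y]_d$ is the space of real polynomials of degree at most $d$. $\Sigma[x,y]_6$ is the cone of sums of squares of real polynomials in $(x,y)$ that have degree at most $6$. ''Generic $R\in\Sigma[x,y]_6$'' means: for all $R\in\Sigma[x,y]_6$ outside a subset of Lebesgue measure zero in the space $\mathbb{R}[x,y]_6$. Elements $w\in\mathbb{R}^{\mathbb{M}[x,y]_{d}}$ are real vectors indexed by the monomials in $\mathbb{M}[x,y]_d$; for $f=\sum c_{\alpha,\beta}x^\alpha y^\beta$ of degree at most $d$, $\langle f,w\rangle:=\sum c_{\alpha,\beta}w_{x^\alpha y^\beta}$; $w|_{\mathcal{E}}$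 is the subvector of $w$ indexed by $\mathcal{E}$, and $w|_{2t}$ the subvector indexed by $\mathbb{M}[x,y]_{2t}$. For $w\in\mathbb{R}^{\mathbb{M}[x,y]_{2k}}$ and a polynomial $\theta$ with $\deg\theta\le2k$, the localizing matrix $L_\theta^{(k)}(w)$ is the symmetric matrix satisfying $\mathrm{vec}(f_1)^TL_\theta^{(k)}(w)\,\mathrm{vec}(f_2)=\langle\theta f_1f_2,w\rangle$ for all polynomials $f_1,f_2$ of degree at most $k-\lceil\deg(\theta)/2\rceil$, where $\mathrm{vec}(f)$ is the coefficient vector of $f$. $M_k(w):=L_1^{(k)}(w)$ is the moment matrix. $L_h^{(k)}(w)=0$ means $L_{h_i}^{(k)}(w)=0$ for every $i$, and $L_g^{(k)}(w)\succeq0$ means $L_{g_j}^{(k)}(w)\succeq0$ for every $j$. A vector $\omega\in\mathbb{R}^{\mathbb{M}[x,y]_{2t}}$ is a flat extension of $\mathbf{a}$ if $\omega|_{\mathcal{E}}=\mathbf{a}$ and $\omega$ is flat with respect to $h=0$, $g\ge0$, that is, $L_h^{(t)}(\omega)=0$, $L_g^{(t)}(\omega)\succeq0$, $M_t(\omega)\succeq0$ and $\operatorname{rank}M_{t-1}(\omega)=\operatorname{rank}M_t(\omega)$. *)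

(* Defs.v *)
From HB Require Import structures.
From mathcomp Require Import all_boot all_order all_algebra.
From mathcomp Require Export mpoly mxtens.
From mathcomp Require Import boolp classical_sets filter reals topology normedtype.

Set Implicit Arguments.
Unset Strict Implicit.
Unset Printing Implicit Defensive.

Import Order.TTheory GRing.Theory Num.Theory numFieldNormedType.Exports.
Local Open Scope classical_set_scope.
Local Open Scope ring_scope.

Definition psd (R : realType) (n : nat) (M : 'M[R]_n) : Prop :=
  M^T = M /\ forall v : 'cV[R]_n, 0 <= (v^T *m M *m v) 0 0.

(* [B *t C] has entry [B i k * C j l] at row [i * q + j] and column
   [k * q + l] (indices from 0), i.e. it is the Kronecker product
   [(B i k *: C)_(i, k)]. *)
Definition separable (R : realType) (p q : nat) (A : 'M[R]_(p * q)) : Prop :=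
  exists (L : nat) (B : 'I_L -> 'M[R]_p) (C : 'I_L -> 'M[R]_q),
    (forall j, psd (B j) /\ psd (C j)) /\ A = \sum_(j < L) (B j *t C j).

(* Real vectors indexed by the monomials of degree at most [d] in [n]
   variables, with the topology of pointwise convergence, which is the usual
   one since the index type is finite. *)
Definition mvec (R : realType) (n d : nat) : Type :=
  {ptws 'X_{1..n < d.+1} -> R}.

HB.instance Definition _ (R : realType) (n d : nat) :=
  Topological.copy (mvec R n d) {ptws 'X_{1..n < d.+1} -> R}.

(* The pairing <f, w>; meaningful when [f] has degree at most [d]. *)
Definition pairing (R : realType) (n d : nat) (f : {mpoly R[n]})
    (w : mvec R n d) : R :=
  \sum_(m : 'X_{1..n < d.+1}) f@_(bmnm m) * w m.

(* The subvector of [w] indexed by monomials of degree at most [e], for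
   [e <= d]: the entry of [w] at the monomial [m] is <'X_[m], w>. *)
Definition trunc (R : realType) (n d e : nat) (w : mvec R n d) : mvec R n e :=
  fun m => pairing 'X_[bmnm m] w.

Arguments trunc {R n d} e w.

Definition coefvec (R : realType) (n d : nat) (f : {mpoly R[n]}) :
    mvec R n d :=
  fun m => f@_(bmnm m).

Arguments coefvec {R n} d f.

(* [msize f] is 1 + the degree of [f], and 0 for [f = 0]. *)
Definition mdegree (R : realType) (n : nat) (f : {mpoly R[n]}) : nat :=
  (msize f).-1.

(* The order of [L_theta^(k)] is the number of monomials of degree at most
   [k - ceil(deg theta / 2)]; its entry at the monomials [m1], [m2] is
   <theta m1 m2, w>.  Vectors [w] of any degree [d >= 2 k] are accepted, so
   that [M_(t-1)] applies directly to vectors of degree [2 t]; only the entries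
   of degree at most [2 k] are used. *)
Definition locmx (R : realType) (n d : nat) (theta : {mpoly R[n]}) (k : nat)
    (w : mvec R n d) :
    'M[R]_(#|{: 'X_{1..n < (k - uphalf (mdegree theta)).+1}}|) :=
  \matrix_(i, j) pairing
    (theta * 'X_[bmnm (enum_val i)] * 'X_[bmnm (enum_val j)]) w.

Definition mommx (R : realType) (n d : nat) (k : nat) (w : mvec R n d) :=
  locmx 1 k w.

Definition sos (R : realType) (n d : nat) (f : {mpoly R[n]}) : Prop :=
  (mdegree f <= d)%N /\
  exists s : seq {mpoly R[n]}, f = \sum_(u <- s) u ^+ 2.

(* Lebesgue-null subsets of the space R^I: countable covers by boxes of
   arbitrarily small total volume. *)
Definition lebesgue_null (R : realType) (I : finType) (N : set (I -> R)) :
    Prop :=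
  forall eps : R, 0 < eps ->
  exists a b : nat -> I -> R,
    [/\ forall k i, a k i <= b k i,
        forall x, N x -> exists k, forall i, a k i <= x i <= b k i
      & forall K : nat, \sum_(k < K) \prod_i (b k i - a k i) <= eps].

(* [P] holds for all [f] in the cone of sums of squares of degree at most [d],
   outside a null subset of the space of polynomials of degree at most [d]. *)
Definition for_generic_sos (R : realType) (n d : nat)
    (P : {mpoly R[n]} -> Prop) : Prop :=
  exists N : set ('X_{1..n < d.+1} -> R),
    lebesgue_null N /\
    forall f : {mpoly R[n]}, sos d f -> ~ N (coefvec d f) -> P f.

Section Relaxation.

Variables (R : realType) (p q : nat).

Definition xvar (i : 'I_p) : {mpoly R[p + q]} := 'X_(lshift q i).
Definition yvar (j : 'I_q) : {mpoly R[p + q]} := 'X_(rshift p j).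

Definition hs : seq {mpoly R[p + q]} :=
  [:: \sum_i xvar i ^+ 2 - 1; \sum_j yvar j ^+ 2 - 1].

Definition gs : seq {mpoly R[p + q]} :=
  [:: \sum_i xvar i; \sum_j yvar j].

(* [w|_E = a]: the monomials of E are x_i y_j x_k y_l with i <= k and j <= l,
   and the entry of [a] at such a monomial is the entry of [A] at row
   [i * q + j] and column [k * q + l]. *)
Definition extends (A : 'M[R]_(p * q)) (d : nat) (w : mvec R (p + q) d) :
    Prop :=
  forall (i k : 'I_p) (j l : 'I_q), (i <= k)%N -> (j <= l)%N ->
    pairing (xvar i * yvar j * xvar k * yvar l) w =
    A (mxtens_index (i, j)) (mxtens_index (k, l)).

Definition localized (k d : nat) (w : mvec R (p + q) d) : Prop :=
  [/\ forall th, th \in hs -> locmx th k w = 0,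
      forall th, th \in gs -> psd (locmx th k w)
    & psd (mommx k w)].

Definition feasible (A : 'M[R]_(p * q)) (k : nat)
    (w : mvec R (p + q) (2 * k)) : Prop :=
  extends A w /\ localized k w.

Definition optimizer (A : 'M[R]_(p * q)) (F : {mpoly R[p + q]}) (k : nat)
    (w : mvec R (p + q) (2 * k)) : Prop :=
  feasible A w /\
  forall w' : mvec R (p + q) (2 * k), feasible A w' ->
    pairing F w <= pairing F w'.

Definition flat_extension (A : 'M[R]_(p * q)) (t : nat)
    (w : mvec R (p + q) (2 * t)) : Prop :=
  [/\ extends A w, localized t w & \rank (mommx t.-1 w) = \rank (mommx t w)].

End Relaxation.

(* Main.v *)
From HB Require Import structures.
Require Import Defs.
From mathcomp Require Import all_boot all_order all_algebra.
From mathcomp Require Import boolp classical_sets filter reals topology normedtype.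
From mathcomp Require Import ring lra zify.

Set Implicit Arguments.
Unset Strict Implicit.
Unset Printing Implicit Defensive.

Import Order.TTheory GRing.Theory Num.Theory numFieldNormedType.Exports.
Local Open Scope classical_set_scope.
Local Open Scope ring_scope.

(** The constraints [h = 0] say that every variable is bounded by 1 in the sense
    [L (x_v^2 s^2) <= L (s^2)], so every functional [L] feasible for a
    relaxation satisfies [|L m| <= L 1 = tr A] on monomials [m].  Limits along an
    ultrafilter therefore exist; they give optimizers of each relaxation, and
    turn an accumulation point of the truncated optimizers into the truncation
    of a functional [L] on all polynomials that is feasible at every order [k]
    and minimizes [F] among such functionals.

    For [F] outside a null set the minimizers agree on degree at most 6: the
    coefficient vectors of linear forms with two minimizers on a bounded set
    lie on countably many Lipschitz graphs.

    If [L (f e) = 0] for all [e] in the edge set E, then [L +- eps L (f .)] is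
    feasible for small [eps], hence also minimal, so uniqueness gives
    [L (f g) = 0] for [deg g <= 6].  Thus, in the quotient by the null ideal
    [{f | L (f^2) = 0}], the component orthogonal to the span of E of a
    polynomial of degree at most 6 is orthogonal to itself, so it vanishes: all
    these polynomials lie in the span of E, which has degree 4.  Multiplying by
    variables, all polynomials lie in it, and the moment matrices have constant
    rank from order 4 on.  No representing measure is needed. *)

(** * Null sets, and linear objectives with several minimizers *)

Section NullSets.
Variables (R : realType) (I : finType).
Implicit Types (S : set (I -> R)) (eps : R).

Definition box_volume (x : (I -> R) * (I -> R)) : R :=
  \prod_i (x.2 i - x.1 i).

Definition finite_box_cover S eps : Prop :=
  exists s : seq ((I -> R) * (I -> R)),
    [/\ forall x, List.In x s -> forall i, x.1 i <= x.2 i,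
        forall c, S c -> exists2 x, List.In x s & forall i, x.1 i <= c i <= x.2 i
      & \sum_(x <- s) box_volume x <= eps].

(* The degenerate box has volume zero only when [I] is inhabited. *)
Lemma lebesgue_null_bigcup (m : I) (S : nat -> set (I -> R)) :
  (forall n eps, 0 < eps -> finite_box_cover (S n) eps) ->
  lebesgue_null (\bigcup_n S n).
Proof.
move=> cov eps eps0.
have cov' n : exists s : seq ((I -> R) * (I -> R)),
    [/\ (0 < size s)%N, forall x, List.In x s -> forall i, x.1 i <= x.2 i,
        forall c, S n c -> exists2 x, List.In x s & forall i, x.1 i <= c i <= x.2 i
      & \sum_(x <- s) box_volume x <= eps / 2 ^+ n.+1].
  have [|s [s1 s2 s3]] := cov n (eps / 2 ^+ n.+1).
    by rewrite divr_gt0 // exprn_gt0.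
  exists ((fun=> 0, fun=> 0) :: s); split=> //.
  - by move=> x /= [<- //|]; apply: s1.
  - by move=> c /s2 [x xs xc]; exists x => //; right.
  - by rewrite big_cons /box_volume /= (bigD1 m) //= subrr mul0r add0r.
have [s sP] := choice cov'.
(* Every [s i] is nonempty, so [cc n] has at least [n] entries and its entries persist in all later
   [cc]. The [k]-th box of the infinite cover can thus be read off [cc k.+1]. *)
pose cc n := flatten [seq s i | i <- iota 0 n].
have ccS n : cc n.+1 = cc n ++ s n.
  by rewrite /cc -addn1 iotaD map_cat flatten_cat /= cats0.
have size_cc n : (n <= size (cc n))%N.
  elim: n => // n IH; rewrite ccS size_cat -addn1 leq_add //.
  by case: (sP n).
have cc_le n k : exists t, cc (n + k)%N = cc n ++ t.
  elim: k => [|k [t IH]]; first by exists [::]; rewrite addn0 cats0.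
  by exists (t ++ s (n + k)%N); rewrite addnS ccS IH catA.
pose d : (I -> R) * (I -> R) := (fun=> 0, fun=> 0).
have nth_cc k K : (k < K)%N -> nth d (cc k.+1) k = nth d (cc K) k.
  move=> kK; have [t] := cc_le k.+1 (K - k.+1)%N; rewrite subnKC // => ->.
  by rewrite nth_cat (leq_trans _ (size_cc _)).
have cc_vol n : \sum_(x <- cc n) box_volume x <= eps - eps / 2 ^+ n.
  elim: n => [|n IH]; first by rewrite big_nil expr0 divr1 subrr.
  rewrite ccS big_cat /=; case: (sP n) => _ _ _ sn.
  apply: (le_trans (lerD IH sn)).
  have -> : eps / 2 ^+ n = 2 * (eps / 2 ^+ n.+1).
    by rewrite exprS invfM (mulrCA 2) mulVKf ?pnatr_eq0.
  lra.
have cc_ok n x : List.In x (cc n) -> forall i, x.1 i <= x.2 i.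
  elim: n => [//|n IH]; rewrite ccS => xcc.
  have [/IH//|xs] := List.in_app_or _ _ _ xcc.
  by case: (sP n) => _ h _ _; apply: h.
have nthIn (t : seq ((I -> R) * (I -> R))) k : (k < size t)%N -> List.In (nth d t k) t.
  elim: t k => [|x t IH] [|k] //= kt; [by left|by right; apply: IH].
have Innth (t : seq ((I -> R) * (I -> R))) x : List.In x t ->
    exists2 k, (k < size t)%N & nth d t k = x.
  elim: t => [//|y t IH] /= [->|/IH [k kt <-]]; first by exists 0%N.
  by exists k.+1.
have vol_ge0 n x : List.In x (cc n) -> 0 <= box_volume x.
  by move=> /cc_ok xok; apply: prodr_ge0 => i _; rewrite subr_ge0.
exists (fun k => (nth d (cc k.+1) k).1), (fun k => (nth d (cc k.+1) k).2); split.
- by move=> k i; apply: (@cc_ok k.+1); apply: nthIn; apply: size_cc.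
- move=> c [n _ Sc]; have [_ _ /(_ c Sc) [x xs xc] _] := sP n.
  have [k ks kx] : exists2 k, (k < size (cc n.+1))%N & nth d (cc n.+1) k = x.
    by apply: Innth; rewrite ccS; apply: List.in_or_app; right.
  exists k => i; suff -> : nth d (cc k.+1) k = x by [].
  rewrite -kx; case: (ltnP k n.+1) => kn; first exact: nth_cc.
  have [t ht] := cc_le n.+1 (k.+1 - n.+1)%N; rewrite subnKC in ht; last exact: ltnW.
  by rewrite ht nth_cat ks.
- move=> K.
  have -> : \sum_(k < K) \prod_i ((nth d (cc k.+1) k).2 i - (nth d (cc k.+1) k).1 i)
     = \sum_(x <- take K (cc K)) box_volume x.
    rewrite (big_nth d) size_takel // big_mkord; apply: eq_bigr => k _.
    by rewrite (@nth_cc k K) // nth_take.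
  apply: (@le_trans _ _ (\sum_(x <- cc K) box_volume x)).
    rewrite -{2}(cat_take_drop K (cc K)) big_cat /= lerDl.
    have : forall x, List.In x (drop K (cc K)) -> 0 <= box_volume x.
      move=> x xd; apply: (@vol_ge0 K); rewrite -(cat_take_drop K (cc K)).
      by apply: List.in_or_app; right.
    elim: (drop K (cc K)) => [|x t IH] h; first by rewrite big_nil.
    rewrite big_cons addr_ge0 //; first by apply: h; left.
    by apply: IH => y yt; apply: h; right.
  by apply: (le_trans (cc_vol K)); rewrite gerBl divr_ge0 ?ltW // exprn_gt0.
Qed.

Lemma grid_cell (n : nat) (d v : R) : 0 <= v <= n.+1%:R * d ->
  exists c : 'I_n.+1, c%:R * d <= v <= c.+1%:R * d.
Proof.
elim: n => [|n IH] /andP [v0 vn]; first by exists ord0; rewrite mul0r v0.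
have [vle|vgt] := leP v (n.+1%:R * d).
  have [|c cP] := IH; first by rewrite v0.
  by exists (widen_ord (leqnSn _) c).
by exists ord_max; rewrite (ltW vgt).
Qed.

(** Cut the cube in the coordinates other than [m] into cells of side [d]. Over one cell the graph
    varies by at most a constant times [d], so boxes of that height cover it with total volume of
    order [d]. *)
Lemma lipschitz_graph_cover (m : I) S (B L : R) : 0 < B -> 0 <= L ->
  (forall x, S x -> forall i, `|x i| <= B) ->
  (forall x y, S x -> S y -> `|x m - y m| <= L * \sum_(i | i != m) `|x i - y i|) ->
  forall eps, 0 < eps -> finite_box_cover S eps.
Proof.
move=> B0 L0 SB SL eps eps0.
pose D := #|predC1 m|.
pose V : R := (2 * B) ^+ D * (2 * (L * (D%:R * (2 * B)))).
(* With [n.+1] cells per axis the boxes have total volume exactly [V / n.+1%:R]. *)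
pose n := Num.truncn (V / eps).
have nV : V / n.+1%:R <= eps.
  rewrite ler_pdivrMr ?ltr0Sn // mulrC -ler_pdivrMr //; apply: ltW.
  exact: truncnS_gt.
pose d : R := 2 * B / n.+1%:R.
have d0 : 0 < d by rewrite divr_gt0 ?mulr_gt0.
have nd : n.+1%:R * d = 2 * B by rewrite /d mulrC divfK // pnatr_eq0.
pose lo (c : {ffun I -> 'I_n.+1}) i : R := - B + (c i)%:R * d.
pose hi (c : {ffun I -> 'I_n.+1}) i : R := - B + (c i).+1%:R * d.
pose incell c (x : I -> R) := S x /\ forall i, i != m -> lo c i <= x i <= hi c i.
(* A point of [S] over the cell fixes the height of its box. A cell without such a point gets the
   default 0, and its box only adds to the volume. *)
pose rep c : I -> R := xget (fun=> 0) (incell c).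
pose ld := L * (D%:R * d).
have ld0 : 0 <= ld by rewrite mulr_ge0 // mulr_ge0 // ltW.
pose bx c : (I -> R) * (I -> R) :=
  (fun i => if i == m then rep c m - ld else lo c i,
   fun i => if i == m then rep c m + ld else hi c i).
have hilo c i : hi c i - lo c i = d.
  by rewrite /hi /lo -natr1; ring.
(* Index functions are forced to be [ord0] at [m], so that cells of the other [D] coordinates are
   listed once and number [n.+1 ^ D]. *)
exists [seq bx c | c <- enum (pffun_on ord0 (predC1 m) predT)]; split.
- move=> x /List.in_map_iff [c [<- _]] i /=; case: eqP => _.
    by move: ld0; lra.
  by rewrite -subr_ge0 hilo ltW.
- move=> x Sx.
  have cell i : exists c : 'I_n.+1, lo [ffun=> c] i <= x i <= hi [ffun=> c] i.
    have [|c /andP [c1 c2]] := @grid_cell n d (x i + B).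
      by move: (SB x Sx i); rewrite nd ler_norml; lra.
    by exists c; rewrite /lo /hi !ffunE; lra.
  have [f fP] := choice cell.
  pose c := [ffun i => if i == m then ord0 else f i].
  have xc : incell c x.
    split=> // i im; move: (fP i).
    by rewrite /lo /hi !ffunE (negPf im).
  have [Sr rc] : incell c (rep c) by apply: (xgetPex (fun=> 0)); exists x.
  exists (bx c).
    apply/List.in_map_iff; exists c; split=> //.
    have : c \in enum (pffun_on ord0 (predC1 m) predT).
      rewrite mem_enum; apply/pffun_onP; split=> //.
      by apply/fintype.subsetP => i; rewrite !inE ffunE; case: (i == m).
    elim: (enum _) => //= y t IH; rewrite inE => /predU1P [->|/IH]; by [left|right].
  move=> i /=; case: (i =P m) => [->|/eqP im]; last by case: xc => _ /(_ i im).
  have : `|x m - rep c m| <= ld.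
    apply: (le_trans (SL _ _ Sx Sr)); rewrite ler_wpM2l // /D mulr_natl.
    rewrite -sumr_const; apply: ler_sum => j jm.
    move: (rc j jm) (hilo c j); case: xc => _ /(_ j jm); rewrite ler_norml.
    by move=> /andP [? ?] /andP [? ?] ?; apply/andP; split; lra.
  by rewrite ler_norml; lra.
- rewrite big_map big_enum /=.
  have vol c : box_volume (bx c) = d ^+ D * (2 * ld).
    rewrite /box_volume (bigD1 m) //= eqxx.
    rewrite (eq_bigr (fun=> d)) => [|i /negPf ->]; last exact: hilo.
    rewrite prodr_const -/D; lra.
  rewrite (eq_bigr (fun=> d ^+ D * (2 * ld))) => [|c _]; last exact: vol.
  rewrite sumr_const card_pffun_on card_ord -/D. rewrite -[_ *+ _]mulr_natl natrX.
  rewrite mulrA -exprMn nd; apply: le_trans nV.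
  by rewrite /V /ld /d le_eqVlt; apply/orP; left; apply/eqP; rewrite !mulrA.
Qed.

Definition linmin (C : set (I -> R)) (c v : I -> R) : Prop :=
  C v /\ forall v', C v' -> \sum_i c i * v i <= \sum_i c i * v' i.

(* If [c] has minimizers on both sides of a gap [s < r] in coordinate [m],
   monotonicity of the minimizer map makes [c m] a Lipschitz function of the
   other coordinates of [c]. *)
Lemma null_nonunique_linmin (m0 : I) (C : set (I -> R)) (M : R) :
  (forall v, C v -> forall i, `|v i| <= M) ->
  lebesgue_null [set c | exists v v', [/\ linmin C c v, linmin C c v' & v <> v']].
Proof.
move=> CM.
(* Countably many pieces: a coordinate, a rational gap between the two minimizers there, and an
   integer bound on the objective. *)
pose jump (t : I * rat * rat * nat) : set (I -> R) :=
  let: (m, s, r, B) := t in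
  [set c | [/\ (s < r)%R, forall i, `|c i| <= B.+1%:R
    & exists v v', [/\ linmin C c v, linmin C c v', v m <= ratr s & ratr r <= v' m]]].
pose S (n : nat) := if unpickle n is Some t then jump t else set0.
suff : lebesgue_null (\bigcup_n S n).
  move=> h eps /h [a [b [ab cov vol]]]; exists a, b; split=> // c cN; apply: cov.
  wlog [v [v' [cv cv' [m vm]]]] : / exists v v',
      [/\ linmin C c v, linmin C c v' & exists m, v m < v' m].
    move=> W; case: cN => v [v' [cv cv' vv']].
    have [m /eqP] : exists m, v m <> v' m.
      by apply/existsNP => vv; apply: vv'; apply/funext.
    rewrite neq_lt => /orP [vm|vm]; apply: W.
      by exists v, v'; split=> //; exists m.
    by exists v', v; split=> //; exists m.
  have [s] := rat_in_itvoo vm; rewrite in_itv /= => /andP [vs sv].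
  have [r] := rat_in_itvoo sv; rewrite in_itv /= => /andP [sr rv].
  pose B := Num.truncn (\sum_i `|c i|).
  exists (pickle (m, s, r, B)) => //; rewrite /S pickleK /=.
  split; [by rewrite ltr_rat in sr| | by exists v, v'; split=> //; exact: ltW].
  move=> i; apply: (@le_trans _ _ (\sum_i `|c i|)).
    by rewrite (bigD1 i) //= lerDl sumr_ge0.
  by apply: ltW; rewrite truncnS_gt.
apply: (lebesgue_null_bigcup m0) => n eps eps0.
rewrite /S; case: unpickle => [[[[m s] r] B]|]; last first.
  by exists [::]; split=> //; rewrite big_nil ltW.
have [sr|rs] := ltP s r; last first.
  exists [::]; split=> //; last by rewrite big_nil ltW.
  by move=> c [] /lt_geF; rewrite rs.
case: (EM (exists v, C v)) => [[v0 Cv0]|C0]; last first.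
  exists [::]; split=> //; last by rewrite big_nil ltW.
  by move=> c [_ _ [v [_ [[Cv _] _ _ _]]]]; exfalso; apply: C0; exists v.
have M0 : 0 <= M by apply: le_trans (CM _ Cv0 m0).
have gap : 0 < ratr r - ratr s :> R by rewrite subr_gt0 ltr_rat.
apply: (@lipschitz_graph_cover m _ B.+1%:R (2 * M / (ratr r - ratr s))) => //.
- by rewrite divr_ge0 ?mulr_ge0 // ltW.
- by move=> c [].
move=> x y Sx Sy.
wlog xy : x y Sx Sy / y m <= x m.
  move=> W; have [|/ltW] := leP (y m) (x m); first exact: W.
  move=> /(W y x Sy Sx); rewrite distrC.
  by under eq_bigr do rewrite distrC.
(* The minimizer above the gap is taken for [x], the one below for [y]; adding their optimality
   inequalities gives monotonicity. *)
case: Sx => _ _ [_ [v' [_ [Cv' xv'] _ v'r]]].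
case: Sy => _ _ [v [_ [[Cv yv] _ vs _]]].
have h1 := xv' _ Cv; have h2 := yv _ Cv'.
have h : \sum_i (x i - y i) * (v' i - v i) <= 0.
  rewrite (_ : \sum_i _ = (\sum_i x i * v' i - \sum_i x i * v i)
     + (\sum_i y i * v i - \sum_i y i * v' i)); first lra.
  by rewrite -!sumrB -big_split /=; apply: eq_bigr => i _; ring.
rewrite ger0_norm ?subr_ge0 // mulrAC ler_pdivlMr //.
apply: (@le_trans _ _ ((x m - y m) * (v' m - v m))).
  by rewrite ler_wpM2l ?subr_ge0 //; lra.
move: h; rewrite (bigD1 m) //= -lerBrDr sub0r => h; apply: (le_trans h).
rewrite -sumrN mulr_sumr; apply: ler_sum => i _.
apply: (le_trans (ler_norm _)); rewrite normrN normrM mulrC ler_wpM2r //.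
apply: (le_trans (ler_normB _ _)).
by rewrite mulr2n mulrDl mul1r lerD // CM.
Qed.

End NullSets.

(** * Linear functionals on polynomials and moment vectors *)

Lemma scalar_exists (R : realType) (V : lmodType R) (f : V -> R) :
  (forall a u v, f (a *: u + v) = a * f u + f v) ->
  exists L : {scalar V}, L =1 f.
Proof.
move=> h; have lf : linear_for *%R f by [].
pose m := GRing.isLinear.Build R V R *%R f lf.
by pose L : {scalar V} := HB.pack f m; exists L.
Qed.

Section Polynomials.
Variables (R : realType) (n : nat).
Implicit Types (f g s : {mpoly R[n]}) (m : 'X_{1..n}) (L : {scalar {mpoly R[n]}}).

Lemma msizeM_leq a b f g :
  (msize f <= a.+1)%N -> (msize g <= b.+1)%N -> (msize (f * g) <= (a + b).+1)%N.
Proof.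
have [->|f0] := eqVneq f 0; first by rewrite mul0r msize0.
have [->|g0] := eqVneq g 0; first by rewrite mulr0 msize0.
move=> fa gb; rewrite msizeM //.
have := leq_add fa gb; rewrite addSn addnS.
by set x := (X in (X <= _)%N -> _); rewrite -/x; case: x.
Qed.

Lemma msizeD_leq d f g :
  (msize f <= d)%N -> (msize g <= d)%N -> (msize (f + g) <= d)%N.
Proof.
by move=> fd gd; apply: (leq_trans (mmeasureD_le _ _ _)); rewrite geq_max fd.
Qed.

Lemma msize_sum_leq (J : Type) (r : seq J) (P : pred J) (F : J -> {mpoly R[n]}) d :
  (forall j, P j -> (msize (F j) <= d)%N) ->
  (msize (\sum_(j <- r | P j) F j) <= d)%N.
Proof.
move=> h; apply: (big_ind (fun f => (msize f <= d)%N)) => //.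
  by rewrite msize0.
by move=> f g; apply: msizeD_leq.
Qed.

Lemma mnm_succ m d : mdeg m = d.+1 ->
  exists i m', m = (U_(i) + m')%MM /\ mdeg m' = d.
Proof.
move=> md.
have [i mi] : exists i, m i != 0%N.
  apply/existsP; rewrite -negb_forall; apply/negP => /forallP m0.
  by move: md; rewrite mdegE big1 // => i _; apply/eqP.
have le1 : (U_(i) <= m)%MM.
  by apply/mnm_lepP => j; rewrite mnm1E; case: eqP => [<-|//]; rewrite lt0n.
have e : m = (U_(i) + (m - U_(i)))%MM by rewrite addmC submK.
by exists i, (m - U_(i))%MM; split=> //; move: md; rewrite {1}e mdegD mdeg1 => -[].
Qed.

Lemma mnm_split m a : (a <= mdeg m)%N ->
  exists m1 m2, m = (m1 + m2)%MM /\ mdeg m1 = a.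
Proof.
elim: a => [|a IH] am; first by exists 0%MM, m; rewrite add0m mdeg0.
have [m1 [m2 [e m1a]]] := IH (ltnW am).
have [|i [m' [e' _]]] := @mnm_succ m2 (mdeg m2).-1.
  by move: am; rewrite e mdegD m1a; lia.
exists (m1 + U_(i))%MM, m'; rewrite mdegD mdeg1 m1a addn1; split=> //.
by rewrite e e' addmA.
Qed.

Lemma scalar_mpolyE L f : L f = \sum_(m <- msupp f) f@_m * L 'X_[m].
Proof.
by rewrite {1}[f]mpolyE linear_sum; apply: eq_bigr => m _; rewrite linearZ.
Qed.

Lemma scalar_mul L g : exists L' : {scalar {mpoly R[n]}}, forall f, L' f = L (g * f).
Proof.
apply: (@scalar_exists R _ (fun f => L (g * f))) => a u v.
by rewrite mulrDr -scalerAr linearD linearZ.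
Qed.

Section MomentVectors.
Variable d : nat.
Implicit Types w : mvec R n d.

Lemma pairing_linear w a f g : pairing (a *: f + g) w = a * pairing f w + pairing g w.
Proof.
rewrite /pairing mulr_sumr -big_split /=; apply: eq_bigr => ? _.
by rewrite mcoeffD mcoeffZ mulrDl mulrA.
Qed.

Lemma pairing_scalar w : exists L, forall f, L f = pairing f w.
Proof. exact: (@scalar_exists R _ (fun f => pairing f w) (pairing_linear w)). Qed.

Lemma pairingX w (m : 'X_{1..n < d.+1}) : pairing 'X_[bmnm m] w = w m.
Proof.
rewrite /pairing (bigD1 m) //= mcoeffX eqxx mul1r big1 ?addr0 // => m' m'm.
by rewrite mcoeffX -bmeqP eq_sym (negPf m'm) mul0r.
Qed.

Definition mvec_of L : mvec R n d := fun m : 'X_{1..n < d.+1} => L 'X_[bmnm m].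

Lemma pairing_mvec_of L f : (msize f <= d.+1)%N -> pairing f (mvec_of L) = L f.
Proof.
move=> fd; rewrite {2}(mpolywE fd) linear_sum; apply: eq_bigr => ? _.
by rewrite linearZ.
Qed.

Lemma pairing_coefvec f w : pairing f w = \sum_(m : 'X_{1..n < d.+1}) coefvec d f m * w m.
Proof. by []. Qed.

End MomentVectors.
End Polynomials.

Arguments mvec_of {R n} d%_nat_scope L _.

(** * Bounds forced by the sphere constraints *)

Section SpherePositivity.
Variables (R : realType) (p q : nat).
Local Notation P := {mpoly R[p + q]}.
Implicit Types (f g s th : P) (L G : {scalar P}).

(** The conditions on $L_h^{(d)}$ and $M_d$ in functional form. The data of [A] and the constraints
    [g] are left out so that [L (g * _)] can be an instance too. *)
Definition sphere_psd (d : nat) G : Prop :=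
  (forall th, th \in hs R p q -> forall f, (msize f <= (2 * (d - 1)).+1)%N -> G (th * f) = 0)
  /\ (forall f, (msize f <= d.+1)%N -> 0 <= G (f ^+ 2)).

(** The constraint rewrites [G (s ^+ 2)] as a sum of values at squares $(x_i s)^2$, each
    nonnegative, and the left side is one of them. *)
Lemma sphere_psd_var d G v s : sphere_psd d G -> (msize s <= d)%N ->
  G ('X_v ^+ 2 * s ^+ 2) <= G (s ^+ 2).
Proof.
move=> [Gh Gsq] sd.
have [->|s0] := eqVneq s 0; first by rewrite expr0n mulr0.
have d0 : (0 < d)%N by apply: leq_trans sd; rewrite lt0n mmeasure_poly_eq0.
have sd1 : (msize s <= (d - 1).+1)%N by rewrite subn1 prednK.
have sd2 : (msize (s ^+ 2) <= (2 * (d - 1)).+1)%N.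
  by rewrite expr2 mul2n -addnn msizeM_leq.
have Gsq' w : 0 <= G ('X_w ^+ 2 * s ^+ 2).
  rewrite -exprMn; apply: Gsq; rewrite -[d](subnKC d0) add1n.
  by apply: (@msizeM_leq R _ 1 (d - 1)) => //; rewrite msizeX mdeg1.
have key (J : finType) (F : J -> 'I_(p + q)) j :
    (\sum_i 'X_(F i) ^+ 2 - 1 : P) \in hs R p q ->
    G ('X_(F j) ^+ 2 * s ^+ 2) <= G (s ^+ 2).
  move=> /Gh /(_ _ sd2); rewrite mulrBl mul1r linearB => /eqP.
  rewrite subr_eq0 => /eqP <-; rewrite mulr_suml linear_sum (bigD1 j) //=.
  by rewrite lerDl sumr_ge0.
rewrite -(splitK v); case: (fintype.split v) => j /=.
  by apply: (key _ (lshift q)); rewrite mem_head.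
by apply: (key _ (@rshift p q)); rewrite !inE eqxx orbT.
Qed.

Lemma sphere_psd_mon d G m s : sphere_psd d G ->
  (mdeg m + msize s <= d.+1)%N -> G (('X_[m] * s) ^+ 2) <= G (s ^+ 2).
Proof.
move=> Gp; move e : (mdeg m) => k; elim: k m e s => [|k IH] m mk s ks.
  by move/eqP: mk; rewrite mdeg_eq0 => /eqP ->; rewrite mpolyX0 mul1r.
have [i [m' [-> m'k]]] := mnm_succ mk.
have [->|s0] := eqVneq s 0; first by rewrite mulr0.
have s1 : (0 < msize s)%N by rewrite lt0n mmeasure_poly_eq0.
rewrite mpolyXD -mulrA exprMn; apply: le_trans (IH m' m'k s _); last by lia.
apply: (sphere_psd_var _ Gp).
move: ks; rewrite -(prednK s1) => ks.
have : (msize ('X_[m'] * s) <= (k + (msize s).-1).+1)%N.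
  by apply: msizeM_leq; rewrite ?msizeX ?m'k // prednK.
move=> h; apply: (leq_trans h); move: ks; rewrite !addSn !addnS !ltnS.
by [].
Qed.

(** Write [m] as a product of two monomials of degree at most [d]. Positivity on the squares of
    their sum and difference bounds the value by the mean of the values at their squares, each at
    most [G 1]. *)
Lemma sphere_psd_bound d G m : sphere_psd d G ->
  (mdeg m <= 2 * d)%N -> `|G 'X_[m]| <= G 1.
Proof.
move=> Gp md.
have [m1 [m2 [e m1d]]] : exists m1 m2, m = (m1 + m2)%MM /\ mdeg m1 = minn d (mdeg m).
  by apply: mnm_split; rewrite geq_minr.
have m2d : (mdeg m2 <= d)%N by move: md m1d; rewrite e mdegD; lia.
have {}m1d : (mdeg m1 <= d)%N by rewrite m1d geq_minl.
have sq m' : (mdeg m' <= d)%N -> G ('X_[m'] ^+ 2) <= G 1.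
  move=> m'd; have := @sphere_psd_mon d G m' 1 Gp.
  by rewrite mulr1 expr1n; apply; rewrite msize1 addn1.
have [_ Gsq] := Gp.
have sD : (msize ('X_[m1] + 'X_[m2] : P) <= d.+1)%N.
  by apply: msizeD_leq; rewrite msizeX.
have sB : (msize ('X_[m1] - 'X_[m2] : P) <= d.+1)%N.
  by apply: msizeD_leq; rewrite ?mmeasureN msizeX.
move: (sq _ m1d) (sq _ m2d) (Gsq _ sD) (Gsq _ sB).
rewrite sqrrD sqrrB !linearD linearN ?linearMn /= e mpolyXD.
move: (G ('X_[m1] ^+ 2)) (G ('X_[m2] ^+ 2)) (G ('X_[m1] * 'X_[m2])) (G 1).
by move=> *; rewrite ler_norml; apply/andP; split; lra.
Qed.

Definition mpoly_l1 f : R := \sum_(m <- msupp f) `|f@_m|.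

(** For a monomial [f], positivity on the squares of $(f \pm 1)s$ together with $G((fs)^2) \le
    G(s^2)$ gives the bound with constant 1; the general case sums over the coefficients. *)
Lemma sphere_psd_mul_bound G f s : (forall d, sphere_psd d G) ->
  `|G (f * s ^+ 2)| <= mpoly_l1 f * G (s ^+ 2).
Proof.
move=> Gp; have Gsq g : 0 <= G (g ^+ 2) by have [_] := Gp (msize g); apply.
have mon m : `|G ('X_[m] * s ^+ 2)| <= G (s ^+ 2).
  have := @sphere_psd_mon (mdeg m + msize s)%N G m s (Gp _) (leqnSn _).
  move: (Gsq (('X_[m] + 1) * s)) (Gsq (('X_[m] - 1) * s)).
  have -> : (('X_[m] + 1) * s) ^+ 2 = ('X_[m] * s) ^+ 2 + ('X_[m] * s ^+ 2) *+ 2 + s ^+ 2.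
    ring.
  have -> : (('X_[m] - 1) * s) ^+ 2 = ('X_[m] * s) ^+ 2 - ('X_[m] * s ^+ 2) *+ 2 + s ^+ 2.
    ring.
  rewrite !linearD linearN ?linearMn /=.
  by move=> *; rewrite ler_norml; apply/andP; split; lra.
rewrite {1}[f]mpolyE mulr_suml linear_sum mulr_suml.
apply: (le_trans (ler_norm_sum _ _ _)); apply: ler_sum => m _.
by rewrite -scalerAl linearZ normrM ler_wpM2l.
Qed.

End SpherePositivity.

(** * Localizing matrices as conditions on functionals *)

Section LocalizingMatrices.
Variables (R : realType) (n d k : nat) (th : {mpoly R[n]}) (w : mvec R n d).
Implicit Types f : {mpoly R[n]}.
Let u := uphalf (mdegree th).
Let B := 'X_{1..n < (k - u).+1}.

Lemma msize_span_enum f : (msize f <= (k - u).+1)%N ->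
  exists v : 'cV[R]_#|{: B}|, f = \sum_i v i 0 *: 'X_[bmnm (enum_val i)].
Proof.
move=> fk; exists (\col_i f@_(bmnm (enum_val i))).
rewrite {1}(mpolywE fk) big_enum_val /=.
by apply: eq_bigr => i _; rewrite mxE.
Qed.

Lemma locmx_form (v : 'cV[R]_#|{: B}|) :
  (v^T *m locmx th k w *m v) 0 0 =
  pairing (th * (\sum_i v i 0 *: 'X_[bmnm (enum_val i)]) ^+ 2) w.
Proof.
have [L Lw] := pairing_scalar w; rewrite -Lw expr2 mulr_sumr mulr_sumr linear_sum /=.
rewrite mxE; apply: eq_bigr => j _; rewrite mxE mulr_suml mulr_suml mulr_sumr.
rewrite linear_sum /=; apply: eq_bigr => i _; rewrite !mxE -Lw.
transitivity (L ((v i 0 * v j 0) *: (th * 'X_[enum_val i] * 'X_[enum_val j]))).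
  by rewrite linearZ /=; ring.
by congr (L _); rewrite -!mul_mpolyC mpolyCM; ring.
Qed.

Lemma psd_locmxP : psd (locmx th k w) <->
  forall f, (msize f <= (k - u).+1)%N -> 0 <= pairing (th * f ^+ 2) w.
Proof.
split=> [[_ h] f /msize_span_enum [v ->]|h]; first by rewrite -locmx_form.
split; first by apply/matrixP => i j; rewrite !mxE mulrAC.
move=> v; rewrite locmx_form; apply: h; apply: msize_sum_leq => i _.
by apply: (leq_trans (msizeZ_le _ _)); rewrite msizeX bmdeg.
Qed.

(** A monomial of degree at most [2 * (k - u)] is a product of two of degree at most [k - u], so the
    matrix entries already test every such [f]. *)
Lemma locmx_eq0P : locmx th k w = 0 <->
  forall f, (msize f <= (2 * (k - u)).+1)%N -> pairing (th * f) w = 0.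
Proof.
have [L Lw] := pairing_scalar w; split=> [h f fk|h]; last first.
  apply/matrixP => i j; rewrite !mxE -mulrA h // -mpolyXD msizeX mdegD.
  by rewrite mul2n -addnn ltnS leq_add // -ltnS bmdeg.
have [L' L'E] := scalar_mul L th; rewrite -Lw -L'E scalar_mpolyE big_seq.
apply: big1 => m /msize_mdeg_lt mf.
have /mnm_split [m1 [m2 [e m1k]]] : (minn (k - u) (mdeg m) <= mdeg m)%N.
  exact: geq_minr.
have m1l : (mdeg m1 < (k - u).+1)%N by rewrite m1k ltnS geq_minl.
have m2l : (mdeg m2 < (k - u).+1)%N.
  have : (mdeg m < (2 * (k - u)).+1)%N by apply: leq_trans fk.
  by move: m1k; rewrite e mdegD; lia.
move/matrixP/(_ (enum_rank (BMultinom m1l : B)) (enum_rank (BMultinom m2l : B))): h.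
by rewrite !mxE !enum_rankK /= L'E Lw e mpolyXD mulrA => ->; rewrite mulr0.
Qed.

End LocalizingMatrices.

(** * Feasible functionals and their mass *)

Section Feasibility.
Variables (R : realType) (p q : nat) (A : 'M[R]_(p * q)).
Local Notation P := {mpoly R[p + q]}.
Implicit Types (f g s th : P) (L G : {scalar P}).

Definition feasible_functional (k : nat) L : Prop :=
  [/\ forall (i k : 'I_p) (j l : 'I_q), (i <= k)%N -> (j <= l)%N ->
        L (xvar R q i * yvar R p j * xvar R q k * yvar R p l) =
        A (mxtens_index (i, j)) (mxtens_index (k, l)),
      sphere_psd k L
    & forall g, g \in gs R p q -> forall f, (msize f <= k)%N -> 0 <= L (g * f ^+ 2)].

Lemma msize_xvar (i : 'I_p) : (msize (xvar R q i) <= 2)%N.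
Proof. by rewrite msizeX mdeg1. Qed.

Lemma msize_yvar (j : 'I_q) : (msize (yvar R p j) <= 2)%N.
Proof. by rewrite msizeX mdeg1. Qed.

Lemma msize_hs th : th \in hs R p q -> (msize th <= 3)%N.
Proof.
rewrite !inE => /orP [] /eqP ->; apply: msizeD_leq;
  rewrite ?mmeasureN ?msize1 //; apply: msize_sum_leq => i _;
  apply: (@msizeM_leq R _ 1 1); by rewrite ?msize_xvar ?msize_yvar.
Qed.

Lemma msize_gs g : g \in gs R p q -> (msize g <= 2)%N.
Proof.
rewrite !inE => /orP [] /eqP ->; apply: msize_sum_leq => i _.
  exact: msize_xvar.
exact: msize_yvar.
Qed.

Lemma msize_gt_coef f m : f@_m != 0 -> (mdeg m < msize f)%N.
Proof. by rewrite -mcoeff_msupp; apply: msize_mdeg_lt. Qed.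

Lemma mcoeff_sumX_gt0 (J : finType) (F : J -> 'X_{1..p + q}) j :
  0 < (\sum_i 'X_[F i] : P)@_(F j).
Proof.
rewrite raddf_sum (bigD1 j) //= mcoeffX eqxx ltr_pwDl //.
by apply: sumr_ge0 => i _; rewrite mcoeffX.
Qed.

(** The order of a localizing matrix depends on the exact degree. Some squared variable has a
    positive coefficient; an empty sum of squares would leave only the constant. *)
Lemma mdegree_hs (hp : (0 < p)%N) (hq : (0 < q)%N) th : th \in hs R p q -> mdegree th = 2.
Proof.
have key m (J : finType) (F : J -> 'I_(p + q)) (j : J) :
    m = (U_(F j) *+ 2)%MM -> (\sum_i 'X_(F i) ^+ 2 - 1 : P)@_m != 0.
  move=> ->; rewrite mcoeffB mcoeff1.
  rewrite (eq_bigr (fun i => 'X_[(U_(F i) *+ 2)%MM])) => [|i _]; last by rewrite mpolyXn.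
  rewrite -mdeg_eq0 mdegMn mdeg1 subr0.
  by rewrite gt_eqF // (@mcoeff_sumX_gt0 _ (fun i => U_(F i) *+ 2)%MM).
move=> thh; have : (2 < msize th)%N.
  move: thh; rewrite !inE => /orP [] /eqP ->.
    have /msize_gt_coef := key _ _ (lshift q) (Ordinal hp) erefl.
    by rewrite mdegMn mdeg1.
  have /msize_gt_coef := key _ _ (@rshift p q) (Ordinal hq) erefl.
  by rewrite mdegMn mdeg1.
move: (msize_hs thh); rewrite /mdegree.
by case: (mmeasure _ th) => [|[|[|[|]]]].
Qed.

Lemma mdegree_gs (hp : (0 < p)%N) (hq : (0 < q)%N) g : g \in gs R p q -> mdegree g = 1.
Proof.
move=> gg; have : (1 < msize g)%N.
  move: gg; rewrite !inE => /orP [] /eqP ->.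
    have := @mcoeff_sumX_gt0 _ (fun i => U_(lshift q i)%MM) (Ordinal hp).
    by move=> /lt0r_neq0 /msize_gt_coef; rewrite mdeg1.
  have := @mcoeff_sumX_gt0 _ (fun i => U_(rshift p i)%MM) (Ordinal hq).
  by move=> /lt0r_neq0 /msize_gt_coef; rewrite mdeg1.
move: (msize_gs gg); rewrite /mdegree.
by case: (mmeasure _ g) => [|[|[|]]].
Qed.

Lemma feasible_functionalP (hp : (0 < p)%N) (hq : (0 < q)%N) d k
    (w : mvec R (p + q) d) L : (0 < k)%N -> (forall f, L f = pairing f w) ->
  extends A w /\ localized k w <-> feasible_functional k L.
Proof.
move=> k0 Lw.
have lochs th : th \in hs R p q -> (locmx th k w = 0 <->
    forall f, (msize f <= (2 * (k - 1)).+1)%N -> L (th * f) = 0).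
  move=> thh; rewrite locmx_eq0P mdegree_hs //.
  by split=> h f fk; move: (h f fk); rewrite Lw.
have locgs g : g \in gs R p q -> (psd (locmx g k w) <->
    forall f, (msize f <= k)%N -> 0 <= L (g * f ^+ 2)).
  move=> gg; rewrite psd_locmxP mdegree_gs // subn1 prednK //.
  by split=> h f fk; move: (h f fk); rewrite Lw.
have loc1 : psd (mommx k w) <-> forall f, (msize f <= k.+1)%N -> 0 <= L (f ^+ 2).
  rewrite /mommx psd_locmxP /mdegree msize1 subn0.
  by split=> h f fk; move: (h f fk); rewrite Lw mul1r.
split=> [[ext [lh lg l1]]|[ext [lh l1] lg]].
  split; [|split|].
  - by move=> i i' j j' ii jj; rewrite Lw; apply: ext.
  - by move=> th thh; apply/(lochs _ thh); apply: lh.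
  - exact/loc1.
  - by move=> g gg; apply/(locgs _ gg); apply: lg.
split; last split.
- by move=> i i' j j' ii jj; rewrite -Lw; apply: ext.
- by move=> th thh; apply/(lochs _ thh) => f; apply: lh.
- by move=> g gg; apply/(locgs _ gg) => f; apply: lg.
- exact/loc1.
Qed.

(** All polynomials tested at order [k] have degree at most [2 * k]; the bound [2 <= k] makes room
    for the monomials of E, of degree 4. *)
Lemma eq_feasible_functional k L L' : (2 <= k)%N ->
  (forall f, (msize f <= (2 * k).+1)%N -> L f = L' f) ->
  feasible_functional k L -> feasible_functional k L'.
Proof.
move=> k2 LL' [ext [lh l1] lg].
have sq f e : (msize f <= e.+1)%N -> (msize (f ^+ 2) <= (e + e).+1)%N.
  by move=> fe; apply: msizeM_leq.
split; [|split|].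
- move=> i i' j j' ii jj; rewrite -LL'; first exact: ext.
  apply: (@leq_trans 5); last by lia.
  apply: (@msizeM_leq R _ 3 1); rewrite ?msize_yvar //.
  apply: (@msizeM_leq R _ 2 1); rewrite ?msize_xvar //.
  by apply: (@msizeM_leq R _ 1 1); rewrite ?msize_xvar ?msize_yvar.
- move=> th thh f fk; rewrite -LL'; first exact: lh.
  have -> : (2 * k = 2 + 2 * (k - 1))%N by lia.
  by apply: msizeM_leq fk; apply: msize_hs.
- move=> f fk; rewrite -LL'; first exact: l1.
  by rewrite mul2n -addnn; apply: sq.
- move=> g gg f fk; rewrite -LL'; first exact: lg.
  have fk' : (msize f <= (k - 1).+1)%N by rewrite subn1 prednK // ltnW.
  have := @msizeM_leq R _ 1 _ _ _ (msize_gs gg) (sq _ _ fk').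
  by move=> h; apply: (leq_trans h); lia.
Qed.

Lemma feasible_functional_leq k k' L : (k <= k')%N ->
  feasible_functional k' L -> feasible_functional k L.
Proof.
move=> kk' [ext [lh l1] lg]; split=> //; last first.
  by move=> g gg f fk; apply: lg => //; apply: leq_trans kk'.
split=> [th thh f fk|f fk]; [apply: lh => //|apply: l1]; apply: (leq_trans fk); lia.
Qed.

(** The trace of [A]. *)
Definition separable_mass : R :=
  \sum_i \sum_j A (mxtens_index (i, j)) (mxtens_index (i, j)).

(** The two sphere constraints give $L(1) = L(x^Tx) = L(x^Tx\,y^Ty)$, and the last value is a sum of
    diagonal entries of [A]. *)
Lemma feasible_functional1 k L : (2 <= k)%N -> feasible_functional k L ->
  L 1 = separable_mass.
Proof.
move=> k2 [ext [lh _] _].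
have hx : L (\sum_i xvar R q i ^+ 2 - 1) = 0.
  rewrite -[_ - 1]mulr1; apply: lh; rewrite ?mem_head // msize1; lia.
have hy : L ((\sum_j yvar R p j ^+ 2 - 1) * \sum_i xvar R q i ^+ 2) = 0.
  apply: lh; first by rewrite !inE eqxx orbT.
  apply: (@leq_trans 3); last by lia.
  by apply: msize_sum_leq => i _; apply: (@msizeM_leq R _ 1 1); rewrite msize_xvar.
have {hx} <- : L (\sum_i xvar R q i ^+ 2) = L 1.
  by apply/eqP; rewrite -subr_eq0 -linearB hx.
move: hy; rewrite mulrBl mul1r linearB => /eqP; rewrite subr_eq0 => /eqP <-.
rewrite mulr_sumr linear_sum; apply: eq_bigr => i _.
rewrite mulr_suml linear_sum; apply: eq_bigr => j _ /=.
by rewrite -ext //; congr (L _); ring.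
Qed.

Lemma feasible_functional_bound k L m : (2 <= k)%N -> feasible_functional k L ->
  (mdeg m <= 2 * k)%N -> `|L 'X_[m]| <= separable_mass.
Proof.
move=> k2 Lf mk; rewrite -(feasible_functional1 k2 Lf).
by case: Lf => _ Lp _; apply: sphere_psd_bound mk.
Qed.

End Feasibility.

(** * Limits of functionals along an ultrafilter *)

Section UltrafilterLimits.
Variables (R : realType) (U : set_system nat).
Hypothesis UU : UltraFilter U.

(** The image of an ultrafilter is an ultrafilter, and it contains a compact interval. *)
Lemma ultra_cvg_bounded (a : nat -> R) (C : R) :
  (forall j, `|a j| <= C) -> exists l : R, a @ U --> l.
Proof.
move=> aC.
have UF : UltraFilter (a @ U).
  split; first exact: fmap_proper_filter.
  move=> G PG FG; rewrite predeqE => S; split; last exact: FG.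
  move=> GS; have [//|nS] := in_ultra_setVsetC (a @^-1` S) UU.
  have /FG GnS : (a @ U) (~` S) by [].
  by exfalso; apply: (@filter_not_empty _ G PG); rewrite -(setICr S); apply: filterI.
have := @segment_compact R (- C) C; rewrite compact_ultra.
have aU : (a @ U) [set` `[- C, C]].
  by apply: (@filterE _ U) => j; rewrite /= in_itv /= -ler_norml aC.
by move=> /(_ _ UF aU) [l [_ la]]; exists l.
Qed.

(** One ultrafilter makes all the bounded sequences [L j f] converge at once, without diagonal
    subsequences; linearity follows from uniqueness of limits. *)
Lemma ultra_scalar_limit (V : lmodType R) (L : nat -> {scalar V}) :
  (forall f, exists C : R, forall j, `|L j f| <= C) ->
  exists l : {scalar V}, forall f, L j f @[j --> U] --> l f.
Proof.
move=> LC; have cvg f : exists l : R, L j f @[j --> U] --> l.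
  by have [C /ultra_cvg_bounded] := LC f.
have [l lP] := choice cvg.
have [|l' l'E] := @scalar_exists R V l; last by exists l' => f; rewrite l'E.
move=> a u v; apply: (@cvg_unique _ (@Rhausdorff R) (L j (a *: u + v) @[j --> U])) => /=.
  exact: lP.
have -> : (fun j => L j (a *: u + v)) = (fun j => a * L j u + L j v).
  by apply/funext => j; rewrite linearD linearZ.
by apply: cvgD => //; apply: cvgM => //; apply: cvg_cst.
Qed.

Variables (p q : nat) (A : 'M[R]_(p * q)).
Variables (L : nat -> {scalar {mpoly R[p + q]}}) (l : {scalar {mpoly R[p + q]}}).
Hypothesis Ll : forall f, L j f @[j --> U] --> l f.

Lemma ultra_limit_ge0 f : (\forall j \near U, 0 <= L j f) -> 0 <= l f.
Proof.
move=> h; rewrite -(cvg_lim (@Rhausdorff R) (@Ll f)).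
by apply: limr_ge h; apply/cvg_ex; exists (l f); apply: Ll.
Qed.

Lemma ultra_limit_eq f (c : R) : (\forall j \near U, L j f = c) -> l f = c.
Proof.
move=> h; apply: (@cvg_unique _ (@Rhausdorff R) (L j f @[j --> U])) => /=; first exact: Ll.
exact: cvg_near_cst.
Qed.

Lemma ultra_limit_feasible k :
  (\forall j \near U, feasible_functional A k (L j)) -> feasible_functional A k l.
Proof.
move=> h; split; [|split|].
- move=> i i' j j' ii jj; apply: ultra_limit_eq.
  by apply: filterS h => n [e _ _]; apply: e.
- move=> th thh f fk; apply: ultra_limit_eq.
  by apply: filterS h => n [_ [e _] _]; apply: e.
- move=> f fk; apply: ultra_limit_ge0.
  by apply: filterS h => n [_ [_ e] _]; apply: e.
- move=> g gg f fk; apply: ultra_limit_ge0.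
  by apply: filterS h => n [_ _ e]; apply: e.
Qed.

End UltrafilterLimits.

(** * Existence of optimizers at each order *)

Section Optimizers.
Variables (R : realType) (p q : nat) (hp : (0 < p)%N) (hq : (0 < q)%N).
Variables (A : 'M[R]_(p * q)).
Local Notation P := {mpoly R[p + q]}.

Lemma feasible_bound k (w : mvec R (p + q) (2 * k)) m : (2 <= k)%N ->
  feasible A w -> `|w m| <= separable_mass A.
Proof.
move=> k2 wf; have [L Lw] := pairing_scalar w.
have k0 : (0 < k)%N by apply: leq_trans k2.
have Lf := (feasible_functionalP A hp hq k0 Lw).1 wf.
by rewrite -(pairingX w) -Lw (feasible_functional_bound k2 Lf) // -ltnS bmdeg.
Qed.

Lemma feasible_pairing_bound k (w : mvec R (p + q) (2 * k)) f : (2 <= k)%N ->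
  feasible A w -> `|pairing f w| <= mpoly_l1 f * separable_mass A.
Proof.
move=> k2 wf; have [L Lw] := pairing_scalar w.
rewrite -Lw scalar_mpolyE mulr_suml; apply: (le_trans (ler_norm_sum _ _ _)).
apply: ler_sum => m _; rewrite normrM ler_wpM2l // Lw.
have [mk|km] := ltnP (mdeg m) (2 * k).+1.
  by rewrite (pairingX w (BMultinom mk)); apply: feasible_bound.
(* A monomial of degree above [2 * k] pairs to 0, so there it suffices that the trace is
   nonnegative. *)
rewrite /pairing big1 ?normr0 => [|m' _]; last first.
  rewrite mcoeffX; case: eqP => [e|]; last by rewrite mul0r.
  by move: km; rewrite e leqNgt bmdeg.
by apply: le_trans (feasible_bound bm0 k2 wf).
Qed.

Lemma feasible_mvec_of k (L : {scalar P}) : (2 <= k)%N ->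
  feasible_functional A k L -> feasible A (mvec_of (2 * k) L).
Proof.
move=> k2 Lf; have [L' L'w] := pairing_scalar (mvec_of (2 * k) L).
have k0 : (0 < k)%N by apply: leq_trans k2.
apply/(feasible_functionalP A hp hq k0 L'w).
by apply: eq_feasible_functional Lf => // f fk; rewrite L'w pairing_mvec_of.
Qed.

(** Direct method: the functionals of a minimizing sequence are bounded, their ultrafilter limit is
    feasible and attains the infimum. *)
Lemma optimizer_exists (F : P) k : (2 <= k)%N -> (msize F <= (2 * k).+1)%N ->
  (exists L, feasible_functional A k L) ->
  exists w : mvec R (p + q) (2 * k), optimizer A F w.
Proof.
move=> k2 Fk [L0 L0f].
pose S : set R := [set pairing F w | w in @feasible R p q A k].
have S0 : S !=set0 by exists (pairing F (mvec_of (2 * k) L0));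
  exists (mvec_of (2 * k) L0) => //; apply: feasible_mvec_of.
have Sb : has_lbound S.
  exists (- (mpoly_l1 F * separable_mass A)) => _ [w wf <-].
  by move: (feasible_pairing_bound F k2 wf); rewrite ler_norml => /andP [].
have near j : exists w : mvec R (p + q) (2 * k), feasible A w /\ pairing F w <= inf S + j.+1%:R^-1.
  have [|_ [w wf <-] /ltW wj] := @inf_adherent R S j.+1%:R^-1 _ (conj S0 Sb).
    by rewrite invr_gt0.
  by exists w.
have [w wP] := choice near.
have [U [UU sU]] := ultraFilterLemma (eventually_filter).
have /choice [L LP] j := pairing_scalar (w j).
have [f|l Ll] := @ultra_scalar_limit R U UU _ L.
  exists (mpoly_l1 f * separable_mass A) => j.
  by rewrite LP; apply: feasible_pairing_bound => //; case: (wP j).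
have k0 : (0 < k)%N by apply: leq_trans k2.
have lf : feasible_functional A k l.
  apply: (ultra_limit_feasible UU Ll); apply: filterE => j.
  by apply/(feasible_functionalP A hp hq k0 (LP j)); case: (wP j).
exists (mvec_of (2 * k) l); split; first exact: feasible_mvec_of.
move=> w' w'f; apply: (@le_trans _ _ (inf S)); last first.
  by apply: ge_inf => //; exists w'.
rewrite pairing_mvec_of //; apply/ler_addgt0Pr => e e0.
rewrite -(cvg_lim (@Rhausdorff R) (Ll F)).
apply: limr_le; first by apply/cvg_ex; exists (l F); apply: Ll.
apply: sU; exists (Num.truncn e^-1) => // j /= ej; rewrite LP.
apply: le_trans (wP j).2 _; rewrite lerD2l invf_ple ?posrE //.
by apply: (le_trans (ltW (truncnS_gt _))); rewrite ler_nat.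
Qed.

End Optimizers.

(** * Positive semidefinite matrices as sums of rank-one matrices *)

Section RankOneSums.
Variables (R : realType) (n : nat).
Implicit Types (M : 'M[R]_n) (u v : 'cV[R]_n).

Let form M u v : R := (u^T *m M *m v) 0 0.

Let tr00 (X : 'M[R]_1) : X 0 0 = X^T 0 0. Proof. by rewrite mxE. Qed.

Let form_entry (X Y Z W : 'M[R]_1) t :
  (X - t *: Y - (t *: Z - t *: (t *: W))) 0 0 = X 0 0 - t * Y 0 0 - t * (Z 0 0 - t * W 0 0).
Proof. by rewrite !mxE mulrBr. Qed.

Lemma formB M u v t : M^T = M ->
  form M (v - t *: u) (v - t *: u) = form M v v - 2 * t * form M u v + t ^+ 2 * form M u u.
Proof.
move=> Ms; have sym : form M v u = form M u v.
  by rewrite /form tr00 !trmx_mul trmxK Ms mulmxA.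
have -> : form M (v - t *: u) (v - t *: u) =
    form M v v - t * form M v u - t * (form M u v - t * form M u u).
  rewrite /form (_ : (v - t *: u)^T = v^T - t *: u^T); last by rewrite linearB linearZ.
  by rewrite !mulmxBl !mulmxBr -!scalemxAl -!scalemxAr !form_entry.
by rewrite sym; ring.
Qed.

Lemma form_delta M i j : form M (delta_mx i 0) (delta_mx j 0) = M i j.
Proof. by rewrite /form trmx_delta -rowE -colE !mxE. Qed.

Lemma psd_diag0 M i j : psd M -> M i i = 0 -> M i j = 0.
Proof.
move=> [Ms Mp] Mii; apply/eqP/negP => /negP Mij.
(* With [M i i = 0] the form at $e_j - t e_i$ is affine in [t], and this [t] gives it the value
   -1. *)
pose t := (M j j + 1) / (2 * M i j).
have := Mp (delta_mx j 0 - t *: delta_mx i 0).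
rewrite -/(form _ _ _) formB // !form_delta Mii mulr0 addr0.
have -> : 2 * t * M i j = M j j + 1 by rewrite /t; field.
lra.
Qed.

(* Each Schur complement step kills a nonzero diagonal entry and creates none,
   a zero diagonal entry of a psd matrix forcing a zero row. *)
Lemma psd_rank1_sum M : psd M -> exists s : seq 'cV[R]_n, M = \sum_(v <- s) v *m v^T.
Proof.
have [k] := ubnP #|[pred i | M i i != 0]|; elim: k M => [//|k IH] M Mk Mp.
case: (pickP [pred i | M i i != 0]) => [i /= Mii|M0]; last first.
  exists [::]; rewrite big_nil; apply/matrixP => i j; rewrite mxE.
  by apply: psd_diag0 => //; move/(_ i): M0 => /negbFE /eqP.
have [Ms Mq] := Mp.
have Mi0 : 0 < M i i.
  by rewrite lt0r Mii -form_delta /form Mq.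
pose c := (Num.sqrt (M i i))^-1 *: col i M.
have cE j l : (c *m c^T) j l = M j i * M l i / M i i.
  rewrite !mxE big_ord1 !mxE; rewrite -[in RHS](sqr_sqrtr (ltW Mi0)).
  by field; rewrite gt_eqF // sqrtr_gt0.
have symM j l : M j l = M l j by rewrite -{1}Ms mxE.
have [|//|s sE] := IH (M - c *m c^T); last first.
- by exists (c :: s); rewrite big_cons -sE addrC subrK.
- split; first by rewrite linearB /= trmx_mul trmxK Ms.
  (* Completing the square: the form of [M - c *m c^T] at [v] is that of [M] at [v] with its
     [M]-projection on $e_i$ removed. *)
  move=> v; have := Mq (v - (form M (delta_mx i 0) v / M i i) *: delta_mx i 0).
  rewrite -/(form _ _ _) formB // form_delta.
  have -> : (v^T *m (M - c *m c^T) *m v) 0 0 = form M v v - form M (delta_mx i 0) v ^+ 2 / M i i.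
    rewrite mulmxBr mulmxBl mxE [X in _ + X]mxE; congr (_ - _).
    rewrite mulmxA -mulmxA mxE big_ord1.
    have -> : (c^T *m v) 0 0 = (Num.sqrt (M i i))^-1 * form M (delta_mx i 0) v.
      rewrite /c linearZ /= -scalemxAl mxE; congr (_ * _).
      by rewrite /form trmx_delta -rowE tr_col Ms.
    have -> : (v^T *m c) 0 0 = (Num.sqrt (M i i))^-1 * form M (delta_mx i 0) v.
      rewrite /c -scalemxAr mxE; congr (_ * _).
      rewrite /form trmx_delta -rowE [RHS]tr00 trmx_mul tr_row Ms.
      by [].
    rewrite -[in RHS](sqr_sqrtr (ltW Mi0)).
    by field; rewrite gt_eqF // sqrtr_gt0.
  move=> h; apply: (le_trans h); rewrite le_eqVlt; apply/orP; left; apply/eqP.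
  by field.
rewrite -ltnS; apply: leq_trans Mk; rewrite ltnS.
rewrite [X in (_ <= X)%N](cardD1 i) [i \in _]inE Mii add1n ltnS.
apply/subset_leq_card/fintype.subsetP => j; rewrite !inE mxE [X in _ + X]mxE cE.
case: (eqVneq j i) => [->|ji] /=; first by rewrite mulfK // subrr eqxx.
by apply: contra => /eqP Mjj; rewrite Mjj (psd_diag0 _ Mp Mjj) mul0r mul0r subr0.
Qed.

End RankOneSums.


(** * Feasible functionals from a separable decomposition *)

Section Atoms.
Variables (R : realType) (p q : nat).
Local Notation P := {mpoly R[p + q]}.
Implicit Types (f g th : P) (L : {scalar P}).

Definition sphere_functional L : Prop :=
  [/\ forall th, th \in hs R p q -> forall f, L (th * f) = 0,
      forall f, 0 <= L (f ^+ 2)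
    & forall g, g \in gs R p q -> forall f, 0 <= L (g * f ^+ 2)].

Definition represented (T : 'I_p -> 'I_q -> 'I_p -> 'I_q -> R) : Prop :=
  exists2 L, sphere_functional L &
    forall i j k l, L (xvar R q i * yvar R p j * xvar R q k * yvar R p l) = T i j k l.

Lemma represented0 : represented (fun _ _ _ _ => 0).
Proof.
have [|L LE] := @scalar_exists R P (fun=> 0).
  by move=> *; rewrite mulr0 addr0.
by exists L => [|*]; [split|] => *; rewrite LE.
Qed.

Lemma representedD T1 T2 : represented T1 -> represented T2 ->
  represented (fun i j k l => T1 i j k l + T2 i j k l).
Proof.
move=> [L1 [h1 s1 g1] e1] [L2 [h2 s2 g2] e2].
have [|L LE] := @scalar_exists R P (fun f => L1 f + L2 f).
  by move=> a f g; rewrite !linearD !linearZ /=; ring.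
exists L => [|*]; last by rewrite LE e1 e2.
split=> *; rewrite LE.
- by rewrite h1 // h2 // addr0.
- by rewrite addr_ge0.
- by rewrite addr_ge0 ?g1 ?g2.
Qed.

(** The functional is evaluation at the normalized vectors, weighted by $|b|^2|c|^2$. A sign flip
    makes each coordinate sum nonnegative and does not change $bb^T$ or $cc^T$. *)
Lemma represented_atom (b : 'cV[R]_p) (c : 'cV[R]_q) :
  represented (fun i j k l => (b *m b^T) i k * (c *m c^T) j l).
Proof.
have normalize r (e : 'cV[R]_r) : e = 0 \/ exists x : 'I_r -> R,
    [/\ \sum_i x i ^+ 2 = 1, 0 <= \sum_i x i &
        exists2 t, 0 <= t & forall i k, (e *m e^T) i k = t * (x i * x k)].
  have [->|e0] := eqVneq e 0; [by left|right].
  pose t := \sum_i e i 0 ^+ 2.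
  have t0 : 0 < t.
    rewrite lt0r sumr_ge0 ?andbT => [|i _]; last exact: sqr_ge0.
    apply: contra e0; rewrite psumr_eq0 => [/allP h|i _]; last exact: sqr_ge0.
    apply/eqP/matrixP => i j; rewrite ord1 mxE; apply/eqP.
    by have := h i (mem_index_enum _); rewrite sqrf_eq0.
  have st : Num.sqrt t ^+ 2 = t by rewrite sqr_sqrtr // ltW.
  have sn0 : Num.sqrt t != 0 by rewrite gt_eqF // sqrtr_gt0.
  pose sg : R := if 0 <= \sum_i e i 0 then 1 else -1.
  have sg2 : sg * sg = 1 by rewrite /sg; case: ifP; rewrite ?mulr1 ?mulrNN ?mulr1.
  exists (fun i => sg * e i 0 / Num.sqrt t); split.
  - under eq_bigr do rewrite !exprMn expr2 sg2 mul1r.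
    by rewrite -mulr_suml exprVn st mulfV // gt_eqF.
  - rewrite -mulr_suml -mulr_sumr divr_ge0 ?sqrtr_ge0 // /sg.
    by case: ifPn; [rewrite mul1r|rewrite -ltNge mulN1r oppr_ge0; apply: ltW].
  - exists t; first exact: ltW.
    move=> i k; rewrite !mxE big_ord1 !mxE -{1}st.
    transitivity ((sg * sg) * (e i 0 * e k 0)); first by rewrite sg2 mul1r.
    by field.
have [->|[x [x1 xs [a a0 aE]]]] := normalize _ b.
  have [L Ls LE] := represented0; exists L => // *.
  by rewrite LE mul0mx mxE mul0r.
have [->|[y [y1 ys [t t0 tE]]]] := normalize _ c.
  have [L Ls LE] := represented0; exists L => // *.
  by rewrite LE mul0mx [X in _ * X]mxE mulr0.
pose v i := match fintype.split i with inl j => x j | inr j => y j end.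
have vx i : (xvar R q i).@[v] = x i.
  by rewrite mevalXU /v (unsplitK (inl i)).
have vy j : (yvar R p j).@[v] = y j.
  by rewrite mevalXU /v (unsplitK (inr j)).
have [|L LE] := @scalar_exists R P (fun f => a * t * f.@[v]).
  by move=> u f g; rewrite mevalD mevalZ; ring.
have at0 : 0 <= a * t by rewrite mulr_ge0.
exists L; last by move=> *; rewrite LE !mevalM !vx !vy aE tE; ring.
split=> [th|f|g].
- rewrite !inE => /orP [] /eqP -> f; rewrite LE mevalM mevalB meval1 raddf_sum /=.
    under eq_bigr do rewrite rmorphXn /= vx.
    by rewrite x1 subrr mul0r mulr0.
  under eq_bigr do rewrite rmorphXn /= vy.
  by rewrite y1 subrr mul0r mulr0.
- rewrite LE rmorphXn /=. exact: mulr_ge0 at0 (sqr_ge0 _).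
- rewrite !inE => /orP [] /eqP -> f; rewrite LE mevalM raddf_sum rmorphXn /=.
    under eq_bigr do rewrite vx.
    exact: (mulr_ge0 at0 (mulr_ge0 _ (sqr_ge0 _))).
  under eq_bigr do rewrite vy.
  exact: (mulr_ge0 at0 (mulr_ge0 _ (sqr_ge0 _))).
Qed.

Lemma represented_sum (J : Type) (r : seq J) T :
  (forall j : J, represented (T j)) ->
  represented (fun i j k l => \sum_(x <- r) T x i j k l).
Proof.
move=> h; elim: r => [|x r IH].
  have [L Ls LE] := represented0; exists L => // *; by rewrite LE big_nil.
have [L Ls LE] := representedD (h x) IH; exists L => // *.
by rewrite LE big_cons.
Qed.

(** Splitting every factor into rank-one terms turns [A] into a sum of Kronecker products of
    rank-one matrices, each given by a point evaluation. *)
Lemma separable_sphere_functional (A : 'M[R]_(p * q)) : separable A ->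
  exists2 L, sphere_functional L &
    forall i j k l, L (xvar R q i * yvar R p j * xvar R q k * yvar R p l) =
      A (mxtens_index (i, j)) (mxtens_index (k, l)).
Proof.
move=> [r [B [C [BC ->]]]].
have term m : represented (fun i j k l => B m i k * C m j l).
  have [/psd_rank1_sum [s ->] /psd_rank1_sum [t ->]] := BC m.
  have [|L Ls LE] := @represented_sum _ s (fun b i j k l =>
      \sum_(c <- t) (b *m b^T) i k * (c *m c^T) j l).
    by move=> b; apply: represented_sum => c; apply: represented_atom.
  exists L => // i j k l; rewrite LE !summxE mulr_suml; apply: eq_bigr => b _.
  by rewrite mulr_sumr.
have [L Ls LE] := represented_sum (index_enum 'I_r) term; exists L => // *.
by rewrite LE summxE; apply: eq_bigr => m _; rewrite tensmxE.
Qed.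

Lemma sphere_functional_feasible (A : 'M[R]_(p * q)) L :
  sphere_functional L ->
  (forall (i k : 'I_p) (j l : 'I_q), (i <= k)%N -> (j <= l)%N ->
    L (xvar R q i * yvar R p j * xvar R q k * yvar R p l) =
      A (mxtens_index (i, j)) (mxtens_index (k, l))) <->
  (forall k, feasible_functional A k L).
Proof.
move=> [h s g]; split=> [e k|/(_ 0%N) [//]].
split=> //; last by move=> ? ? ? _; apply: g.
by split=> [? ? ? _|? _]; [apply: h|apply: s].
Qed.

Lemma feasible_sphere_functional (A : 'M[R]_(p * q)) L :
  (forall k, feasible_functional A k L) -> sphere_functional L.
Proof.
move=> Lf; split=> [th thh f|f|g gg f].
- have [_ [h _] _] := Lf (msize f).+1; apply: h => //; lia.
- by have [_ [_ h] _] := Lf (msize f); apply: h.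
- by have [_ _ h] := Lf (msize f); apply: h.
Qed.

End Atoms.

(** * Feasible perturbations of a functional *)

Section Perturbation.
Variables (R : realType) (p q : nat) (A : 'M[R]_(p * q)).
Local Notation P := {mpoly R[p + q]}.
Implicit Types (f g th : P) (L : {scalar P}).

(** All index quadruples are allowed: by commutativity they give the same monomials as E. *)
Definition edge (x : 'I_p * 'I_q * 'I_p * 'I_q) : P :=
  let: (i, j, k, l) := x in xvar R q i * yvar R p j * xvar R q k * yvar R p l.

Lemma msize_edge x : (msize (edge x) <= 5)%N.
Proof.
case: x => [[[i j] k] l] /=.
apply: (@msizeM_leq R _ 3 1); rewrite ?msize_yvar //.
apply: (@msizeM_leq R _ 2 1); rewrite ?msize_xvar //.
by apply: (@msizeM_leq R _ 1 1); rewrite ?msize_xvar ?msize_yvar.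
Qed.

(** Adding [t * L (f * _)] keeps the entries on E and the vanishing on multiples of [h]. Positivity
    survives for small [t] because $|L(f s^2)|$ is at most a constant times $L(s^2)$. *)
Lemma feasible_perturbation L f : (forall k, feasible_functional A k L) ->
  (forall x, L (f * edge x) = 0) ->
  exists2 e : R, 0 < e & forall t, `|t| <= e ->
    exists2 L' : {scalar P}, (forall k, feasible_functional A k L') &
      forall g, L' g = L g + t * L (f * g).
Proof.
move=> Lf fE; have [Lh Ls Lg] := feasible_sphere_functional Lf.
have c0 : 0 <= mpoly_l1 f by apply: sumr_ge0.
exists (mpoly_l1 f + 1)^-1; first by rewrite invr_gt0 ltr_wpDl.
move=> t te; have [|L' L'E] := @scalar_exists R P (fun g => L g + t * L (f * g)).
  move=> a u v; rewrite mulrDr -scalerAr !linearD !linearZ /=; ring.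
have pos (G : {scalar P}) s : (forall d, sphere_psd d G) ->
    0 <= G (s ^+ 2) + t * G (f * s ^+ 2).
  move=> Gp; have Gs : 0 <= G (s ^+ 2) by have [_] := Gp (msize s); apply.
  have : `|t * G (f * s ^+ 2)| <= G (s ^+ 2).
    rewrite normrM; apply: le_trans (ler_pM _ _ te (sphere_psd_mul_bound f s Gp)) _ => //.
    by rewrite mulrA ler_piMl // mulrC ler_pdivrMr ?ltr_wpDl // mul1r lerDl.
  by rewrite ler_norml; lra.
have Lp d : sphere_psd d L by case: (Lf d).
exists L' => //; apply/sphere_functional_feasible; last first.
  move=> i k j l ik jl; rewrite L'E (fE (i, j, k, l)) mulr0 addr0.
  by have [e _ _] := Lf 0%N; apply: e.
split=> [th thh g|g|g gg s]; rewrite L'E.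
- by rewrite (mulrCA f) !Lh // mulr0 addr0.
- exact: pos.
(* For [g] the same bound is applied to [L (g * _)], which is again nonnegative on squares and zero
   on multiples of [h]. *)
have [G GE] := scalar_mul L g; rewrite (mulrCA f) -!GE; apply: pos => d.
split=> [th thh h _|h _]; rewrite GE; last exact: Lg.
by rewrite (mulrCA g) Lh.
Qed.

End Perturbation.

(** * The quotient by the null ideal and ranks of moment matrices *)

Section NullIdeal.
Variables (R : realType) (n : nat) (L : {scalar {mpoly R[n]}}).
Hypothesis Lsq : forall f, 0 <= L (f ^+ 2).
Implicit Types (f g r : {mpoly R[n]}).

Definition null_poly f : Prop := forall g, L (f * g) = 0.

(** Cauchy-Schwarz in the degenerate case: $L((g - tf)^2)$ is affine in [t], and a nonzero slope
    would let it reach -1. *)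
Lemma null_poly_sq f : L (f ^+ 2) = 0 -> null_poly f.
Proof.
move=> f0 g; apply/eqP/negP => /negP fg.
have := Lsq (g - ((L (g ^+ 2) + 1) / (2 * L (f * g))) *: f).
set t := _ / _.
have -> : (g - t *: f) ^+ 2 = g ^+ 2 - (2 * t) *: (f * g) + t ^+ 2 *: f ^+ 2.
  by rewrite sqrrB exprZn -scalerAr -scaler_nat scalerA (mulrC g).
have LZ a h : L (a *: h) = a * L h by rewrite linearZ.
rewrite linearD linearB !LZ f0 mulr0 addr0.
have -> : 2 * t * L (f * g) = L (g ^+ 2) + 1 by rewrite /t; field.
lra.
Qed.

(** Orthogonal projection, also for a singular Gram matrix: a kernel vector gives a combination [u]
    with [L (u ^+ 2) = 0], hence orthogonal to [f], so the normal equations are solvable. *)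
Lemma gram_projection N (E : 'I_N -> {mpoly R[n]}) f :
  exists c : 'I_N -> R, forall j, L ((f - \sum_i c i *: E i) * E j) = 0.
Proof.
pose G : 'M[R]_N := \matrix_(i, j) L (E i * E j).
pose b : 'rV[R]_N := \row_j L (f * E j).
have : (b <= G)%MS.
  rewrite submxE; move: (mulmx_coker G); move: (cokermx G) => K GK.
  apply/eqP/rowP => j; rewrite !mxE.
  pose u := \sum_i K i j *: E i.
  have uE g : L (g * u) = \sum_i L (g * E i) * K i j.
    rewrite mulr_sumr linear_sum; apply: eq_bigr => i _ /=.
    by rewrite -scalerAr linearZ /= mulrC.
  have uEi i : L (u * E i) = 0.
    rewrite mulrC uE; have /matrixP/(_ i j) := GK.
    rewrite !mxE => h; rewrite -[RHS]h. by apply: eq_bigr => k _; rewrite mxE.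
  have /null_poly_sq/(_ f) : L (u ^+ 2) = 0.
    by rewrite expr2 uE big1 // => i _; rewrite uEi mul0r.
  rewrite mulrC uE => h; rewrite -[RHS]h.
  by apply: eq_bigr => i _; rewrite mxE.
move=> /submxP [c bc]; exists (fun i => c 0 i) => j.
rewrite mulrBl linearB mulr_suml linear_sum /=; apply/eqP; rewrite subr_eq0.
move/rowP/(_ j): bc; rewrite !mxE => ->; apply/eqP/eq_bigr => i _.
by rewrite mxE -scalerAl linearZ.
Qed.

(** Substituting the combinations writes the first Gram matrix as $C G C^T$, with $G$ the second. *)
Lemma gram_rank_le N M (a : 'I_N -> {mpoly R[n]}) (b : 'I_M -> {mpoly R[n]}) :
  (forall i, exists c : 'I_M -> R, null_poly (a i - \sum_j c j *: b j)) ->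
  (\rank (\matrix_(i, j) L (a i * a j)%R) <= \rank (\matrix_(i, j) L (b i * b j)%R))%N.
Proof.
move=> /choice [c cP]; pose C := \matrix_(i, j) c i j.
suff -> : (\matrix_(i, j) L (a i * a j) : 'M[R]_N)
    = C *m (\matrix_(i, j) L (b i * b j)) *m C^T.
  by apply: leq_trans (mxrankM_maxl _ _) (mxrankM_maxr _ _).
have swap i g : L (a i * g) = \sum_j c i j * L (b j * g).
  have := cP i g; rewrite mulrBl linearB mulr_suml linear_sum /= => /eqP.
  rewrite subr_eq0 => /eqP ->.
  by apply: eq_bigr => j _; rewrite -scalerAl linearZ.
apply/matrixP => i i'; rewrite -mulmxA !mxE.
apply: etrans (swap i (a i')) _; apply: eq_bigr => j _.
rewrite !mxE; congr (_ * _); rewrite (mulrC (b j)); apply: etrans (swap i' (b j)) _.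
by apply: eq_bigr => j' _; rewrite !mxE mulrC (mulrC (b j')).
Qed.

Variables (J : finType) (E : J -> {mpoly R[n]}).

Definition reducible f : Prop := exists c : J -> R, null_poly (f - \sum_j c j *: E j).

Lemma reducible_cong f g : null_poly (f - g) -> reducible g -> reducible f.
Proof.
move=> fg [c cP]; exists c => r.
by rewrite -[f](subrK g) -addrA mulrDl linearD fg cP addr0.
Qed.

Lemma reducible_lin a f g : reducible f -> reducible g -> reducible (a *: f + g).
Proof.
move=> [c cP] [c' c'P]; exists (fun j => a * c j + c' j) => r.
have -> : \sum_j (a * c j + c' j) *: E j =
    a *: (\sum_j c j *: E j) + \sum_j c' j *: E j.
  by rewrite scaler_sumr -big_split /=; apply: eq_bigr => j _; rewrite scalerDl scalerA.
rewrite (_ : _ - _ = a *: (f - \sum_j c j *: E j) + (g - \sum_j c' j *: E j)).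
  by rewrite mulrDl linearD -scalerAl linearZ /= cP c'P mulr0 addr0.
by rewrite scalerBr opprD addrACA.
Qed.

Variable (d : nat).
Hypothesis Ed : forall j, (msize (E j) <= d)%N.
Hypothesis Eorth : forall f, (forall j, L (f * E j) = 0) ->
  forall g, (msize g <= d.+1)%N -> L (f * g) = 0.

(** The residual of the projection is orthogonal to [E] and within the size bound, so [Eorth] makes
    it orthogonal to itself, hence null. *)
Lemma reducible_msize f : (msize f <= d.+1)%N -> reducible f.
Proof.
move=> fd; have [c cP] := gram_projection (fun i : 'I_#|J| => E (enum_val i)) f.
pose c' j := c (enum_rank j).
have sumE : \sum_i c i *: E (enum_val i) = \sum_j c' j *: E j.
  rewrite [RHS](reindex _ (onW_bij _ (@enum_val_bij J))) /=.
  by apply: eq_bigr => i _; rewrite /c' enum_valK.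
exists c'; apply: null_poly_sq; rewrite expr2; apply: Eorth.
  by move=> j; move: (cP (enum_rank j)); rewrite sumE enum_rankK.
apply: msizeD_leq => //; rewrite mmeasureN; apply: msize_sum_leq => j _.
by apply: (leq_trans (msizeZ_le _ _)); apply: leqW.
Qed.

(** Induction on the degree: in $x_i m$ replace $m$ by a combination of [E]. The products $x_i E_j$
    exceed the size bound of [E] by one at most, which is covered by the previous lemma. *)
Lemma reducible_all f : reducible f.
Proof.
have r0 : reducible 0 by apply: reducible_msize; rewrite msize0.
have mon m : reducible 'X_[m].
  move e : (mdeg m) => k; elim: k m e => [|k IH] m mk.
    by apply: reducible_msize; rewrite msizeX mk.
  have [i [m' [-> m'k]]] := mnm_succ mk; have [c cP] := IH _ m'k.
  apply: (@reducible_cong _ ('X_i * \sum_j c j *: E j)).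
    by move=> g; rewrite mpolyXD -mulrBr -mulrA mulrCA cP.
  rewrite mulr_sumr; apply: (big_ind reducible) => //.
    by move=> u v ru rv; rewrite -[u]scale1r; apply: reducible_lin.
  move=> j _; rewrite -scalerAr -[_ *: _]addr0; apply: reducible_lin => //.
  apply: reducible_msize.
  have [->|E0] := eqVneq (E j) 0; first by rewrite mulr0 msize0.
  have := Ed j; have : (0 < msize (E j))%N by rewrite lt0n mmeasure_poly_eq0.
  case: d => [|d' _ Ej]; first by case: (mmeasure _ _).
  by apply: (@msizeM_leq R _ 1 d') => //; rewrite msizeX mdeg1.
rewrite [f]mpolyE; apply: (big_ind reducible) => //.
  by move=> u v ru rv; rewrite -[u]scale1r; apply: reducible_lin.
by move=> m _; rewrite -[_ *: _]addr0; apply: reducible_lin.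
Qed.

(** Moment matrices are Gram matrices of monomials. The condition [d <= k'.+1] puts [E] in the span
    of the monomials of degree at most [k'], which therefore span everything modulo null
    polynomials. *)
Lemma mommx_rank_le t k k' : (k <= t)%N -> (k' <= t)%N -> (d <= k'.+1)%N ->
  (\rank (mommx k (mvec_of (2 * t) L)) <= \rank (mommx k' (mvec_of (2 * t) L)))%N.
Proof.
move=> kt k't dk'.
have mom e : (e <= t)%N -> mommx e (mvec_of (2 * t) L) = \matrix_(i, j) L
    ('X_[bmnm (enum_val i)] * 'X_[bmnm (enum_val j)]).
  move=> et; apply/matrixP => i j; rewrite !mxE mul1r pairing_mvec_of //.
  have deg (x : 'X_{1..n < (e - uphalf (mdegree (1 : {mpoly R[n]}))).+1}) : (mdeg x <= t)%N.
    by rewrite -ltnS (leq_trans (bmdeg x)) // ltnS (leq_trans (leq_subr _ _)).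
  by rewrite -mpolyXD msizeX mdegD mul2n -addnn ltnS leq_add.
rewrite !mom //; apply: gram_rank_le => i.
have [c cP] := reducible_all 'X_[bmnm (enum_val i)].
have [|v vE] := @msize_span_enum R n k' 1 (\sum_j c j *: E j).
  rewrite /mdegree msize1 subn0; apply: msize_sum_leq => j _.
  by apply: (leq_trans (msizeZ_le _ _)); apply: leq_trans dk'.
by exists (fun j => v j 0); rewrite -vE.
Qed.

End NullIdeal.

(** Clustering says that preimages of neighbourhoods of [x] meet every tail; together they generate
    a proper filter, which any finer ultrafilter extends. *)
Lemma cluster_ultrafilter (T : topologicalType) (u : nat -> T) (x : T) :
  cluster (u @ \oo) x ->
  exists U : set_system nat, [/\ UltraFilter U, \oo `<=` U & u @ U --> x].
Proof.
move=> ux; pose F : set_system nat := [set B | exists2 V, nbhs x V &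
  exists2 S, \oo S & u @^-1` V `&` S `<=` B].
have FF : ProperFilter F.
  split.
    move=> [V xV [S S1 VS]].
    have [|y [[n Sn <-] Vy]] := ux (u @` S) V _ xV.
      by apply: filterS S1 => n Sn; exists n.
    by apply: (VS n).
  split.
  - by exists setT; [apply: filterT|exists setT => //; apply: filterT].
  - move=> B1 B2 [V1 xV1 [S1 S1o h1]] [V2 xV2 [S2 S2o h2]].
    exists (V1 `&` V2); first exact: filterI.
    exists (S1 `&` S2); first exact: filterI.
    by move=> n [[v1 v2] [s1 s2]]; split; [apply: h1|apply: h2].
  - by move=> B1 B2 B12 [V xV [S So h]]; exists V => //; exists S => // n /h /B12.
have [U [UU FU]] := ultraFilterLemma FF; exists U; split=> //.
- by move=> S So; apply: FU; exists setT; [apply: filterT|exists S => // n []].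
- by move=> V xV; apply: FU; exists V => //; exists setT; [apply: filterT|move=> n []].
Qed.

(** * Flatness of the unique minimizer *)

Section FlatLimit.
Variables (R : realType) (p q : nat) (hp : (0 < p)%N) (hq : (0 < q)%N).
Variables (A : 'M[R]_(p * q)) (F : {mpoly R[p + q]}).
Hypothesis F6 : (msize F <= 7)%N.
Local Notation P := {mpoly R[p + q]}.
Implicit Types (f g : P) (L : {scalar P}).

(** It depends on [A] only, so the exceptional null set of objectives is fixed before [F]. *)
Definition moment_section : set ('X_{1..(p + q)%N < 7} -> R) :=
  [set v | exists2 L, (forall k, feasible_functional A k L) & v = mvec_of 6 L].

Lemma moment_section_bound v : moment_section v -> forall m, `|v m| <= separable_mass A.
Proof.
move=> [L Lf ->] m; apply: (@feasible_functional_bound _ _ _ _ 3) => //.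
by rewrite -ltnS bmdeg.
Qed.

Hypothesis F_unique : ~ exists v v',
  [/\ linmin moment_section (coefvec 6 F) v, linmin moment_section (coefvec 6 F) v'
    & v <> v'].

Variable L : {scalar P}.
Hypothesis Lf : forall k, feasible_functional A k L.
Hypothesis Lmin : forall L', (forall k, feasible_functional A k L') -> L F <= L' F.

Lemma linmin_mvec_of L' : (forall k, feasible_functional A k L') -> L' F = L F ->
  linmin moment_section (coefvec 6 F) (mvec_of 6 L').
Proof.
move=> L'f L'F; split; first by exists L'.
move=> _ [L'' L''f ->].
by rewrite -!pairing_coefvec !pairing_mvec_of // L'F; apply: Lmin.
Qed.

Lemma minimizer_orthogonal f : (forall x, L (f * edge R x) = 0) ->
  forall g, (msize g <= 6)%N -> L (f * g) = 0.
Proof.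
move=> fE g g6; have [e e0 eP] := feasible_perturbation Lf fE.
have [|L1 L1f L1E] := eP e; first by rewrite ger0_norm // ltW.
have [|L2 L2f L2E] := eP (- e); first by rewrite normrN ger0_norm // ltW.
(* Minimality against the perturbations of both signs. *)
have fF : e * L (f * F) = 0.
  by have := Lmin L1f; have := Lmin L2f; rewrite L1E L2E; lra.
have eq6 : mvec_of 6 L = mvec_of 6 L1.
  apply: contrapT => ne; apply: F_unique; exists (mvec_of 6 L), (mvec_of 6 L1).
  by split=> //; apply: linmin_mvec_of => //; rewrite L1E fF addr0.
have [Lm LmE] := scalar_mul L f; rewrite -LmE scalar_mpolyE big_seq big1 // => m mg.
have m6 : (mdeg m < 7)%N by apply: (ltn_trans (msize_mdeg_lt mg)).
have := congr1 (fun v : mvec R (p + q) 6 => v (BMultinom m6)) eq6.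
rewrite /mvec_of /= L1E -[LHS]addr0 => /addrI /esym /eqP.
by rewrite mulf_eq0 gt_eqF //= LmE => /eqP ->; rewrite mulr0.
Qed.

(** From [t = 5] on, already the moment matrix of order [t.-1] involves all monomials of degree 4,
    hence all of E. *)
Lemma minimizer_flat t : (5 <= t)%N -> flat_extension A (mvec_of (2 * t) L).
Proof.
move=> t5; have t2 : (2 <= t)%N by apply: leq_trans t5.
have [ext loc] := feasible_mvec_of hp hq t2 (Lf t); split=> //.
have [_ Lsq _] := feasible_sphere_functional Lf.
have le := mommx_rank_le Lsq (@msize_edge R p q) minimizer_orthogonal.
by apply/eqP; rewrite eqn_leq; apply/andP; split; apply: le; lia.
Qed.

End FlatLimit.

(** * Existence, boundedness and flat accumulation points for generic objectives *)

Theorem theorem4p4 (R : realType) (p q : nat) (hp : (0 < p)%N) (hq : (0 < q)%N)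
    (A : 'M[R]_(p * q)) (hA : separable A) :
  for_generic_sos 6 (fun F : {mpoly R[p + q]} =>
    (forall k : nat, (3 <= k)%N ->
      exists w : mvec R (p + q) (2 * k), optimizer A F w) /\
    (exists T : nat, forall t : nat, (T <= t)%N ->
      forall w : (forall k : nat, mvec R (p + q) (2 * k)),
        (forall k : nat, (3 <= k)%N -> optimizer A F (w k)) ->
        let u : nat -> mvec R (p + q) (2 * t) :=
          fun j => trunc (2 * t) (w (t + j)%N) in
        (exists C : R, forall j m, `|u j m| <= C) /\
        (forall om : mvec R (p + q) (2 * t),
          cluster (u @ \oo) om -> flat_extension A om))).
Proof.
have N_null := null_nonunique_linmin bm0 (@moment_section_bound R p q A).
exists [set c | exists v v', [/\ linmin (moment_section A) c v,
  linmin (moment_section A) c v' & v <> v']]; split=> // F [F6 _] F_unique.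
have {}F6 : (msize F <= 7)%N by move: F6; rewrite /mdegree; case: (mmeasure _ _).
split=> [k k3|].
  apply: (optimizer_exists hp hq) => //; first exact: ltnW.
    by apply: (leq_trans F6); lia.
  have [L Ls LE] := separable_sphere_functional hA; exists L.
  by apply: (sphere_functional_feasible A Ls).1 => i i' j j' _ _; apply: LE.
exists 5 => t t5 w w_opt u.
have tj3 j : (3 <= t + j)%N by rewrite (leq_trans _ (leq_addr _ _)) // (leq_trans _ t5).
have wf j : feasible A (w (t + j)%N) by have [] := w_opt _ (tj3 j).
have tj2 j : (2 <= t + j)%N by apply: ltnW.
split.
  exists (separable_mass A) => j m.
  have mk : (mdeg m < (2 * (t + j)).+1)%N.
    by apply: (leq_trans (bmdeg m)); rewrite ltnS leq_mul2l leq_addr.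
  by rewrite /u /trunc (pairingX _ (BMultinom mk)); apply: (feasible_bound hp hq).
move=> om /cluster_ultrafilter [U [UU oU uom]].
(* The optimizers, extended by 0 to higher degrees, converge along [U] on every polynomial; the
   limit [l] extends [om] to all degrees. *)
have /choice [L LP] j := pairing_scalar (w (t + j)%N).
have [f|l Ll] := @ultra_scalar_limit R U UU _ L.
  by exists (mpoly_l1 f * separable_mass A) => j; rewrite LP; apply: feasible_pairing_bound.
have -> : om = mvec_of (2 * t) l.
  apply/funext => m; apply: (@cvg_unique _ (@Rhausdorff R) (u j m @[j --> U])).
    exact: (cvg_comp _ _ uom (@proj_continuous _ _ m om)).
  by rewrite /= (_ : (fun j => u j m) = (fun j => L j 'X_[bmnm m])) //;
    apply/funext => j; rewrite LP.
apply: (minimizer_flat hp hq F6 F_unique) => //.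
  (* Order [k] is reached as soon as [k <= j], which holds eventually along [U]. *)
  move=> k; apply: (ultra_limit_feasible UU Ll); apply: oU; exists k => // j /= kj.
  apply: (@feasible_functional_leq _ _ _ _ _ (t + j)); first exact: leq_trans (leq_addl _ _).
  exact: (feasible_functionalP A hp hq (ltnW (tj2 j)) (LP j)).1 (wf j).
(* A functional feasible at all orders truncates to a competitor of every optimizer, so its value
   bounds their values and the limit. *)
move=> L' L'f; rewrite -(cvg_lim (@Rhausdorff R) (Ll F)).
apply: limr_le; first by apply/cvg_ex; exists (l F); apply: Ll.
apply: filterE => j; rewrite LP; have [_ opt] := w_opt _ (tj3 j).
have := opt _ (feasible_mvec_of hp hq (tj2 j) (L'f _)).
by rewrite pairing_mvec_of // (leq_trans F6) //; lia.
Qed.
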